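(* Every cactus admits a reducible regular outside-obstacle representation (OOR).
   Context: All graphs are finite and simple. A cactus is a connected graph in which every edge is contained in at most one simple cycle. A straight-line drawing $\Gamma$ of a graph $G$ maps the vertices to pairwise distinct points of $\mathbb{R}^2$ and each edge to the closed line segment between its endpoints. The outer face of $\Gamma$ is the unbounded connected component of the complement in $\mathbb{R}^2$ of the union of all vertex points and edge segments. The planarization of $\Gamma$ is obtained by replacing all intersection points of edges by dummy vertices (so edges are subdivided at crossings). A non-edge of $G$ is a pair of distinct non-adjacent vertices; it is identified with the line segment between its endpoints. An outside-obstacle representation (OOR) of $G$ is a straight-line drawing of $G$ such that no edge segment contains a vertex point other than its two endpoints and every non-edge segment intersects the outer face of the drawing. (Equivalently, $G$ is the visibility graph of the point set with respect to a single obstacle, namely the open outer face of the drawing.) An OOR of a graph with $n$ vertices is regular if the vertex points form a regular $n$-gon, i.e., they are $n$ equally spaced points on a circle. An OOR is reducible if every edge is incident to the outer face, i.e., for every edge at least one of the sub-segments into which it is divided in the planarization lies on the boundary of the outer face. *)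

(* Defs.v *)
From mathcomp Require Import all_boot all_order all_algebra.
From mathcomp Require Import all_classical all_reals all_analysis.
Import Order.TTheory GRing.Theory Num.Theory.
Import numFieldNormedType.Exports.

Set Implicit Arguments.
Unset Strict Implicit.
Unset Printing Implicit Defensive.

(* A finite simple graph is given by its adjacency relation [e : rel T] on a
   [finType], with [symmetric e] and [irreflexive e] as hypotheses where used. *)
Section Graphs.
Variables (T : finType) (e : rel T).

(* [c] lists the vertices of a cycle in cyclic order; the bound on the size
   excludes the degenerate [:: x; y], which is a [ucycle] for every edge xy. *)
Definition simple_cycle (c : seq T) : Prop := ucycle e c /\ (2 < size c)%N.

(* Different lists (rotations, reversals) represent the same cycle, so cycles
   are compared by their edge sets. *)
Definition cycle_edges (c : seq T) : {set {set T}} :=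
  [set [set x; next c x]%SET | x in c]%SET.

Definition cactus : Prop :=
  (forall x y : T, connect e x y) /\
  (forall (x y : T) (c1 c2 : seq T), e x y ->
     simple_cycle c1 -> simple_cycle c2 ->
     [set x; y]%SET \in cycle_edges c1 -> [set x; y]%SET \in cycle_edges c2 ->
     cycle_edges c1 = cycle_edges c2).

End Graphs.

Local Open Scope classical_set_scope.
Local Open Scope ring_scope.

Section Plane.
Variable R : realType.

Definition segment (p q : R * R) : set (R * R) :=
  [set (1 - t) *: p + t *: q | t in `[0, 1]].

Definition open_segment (p q : R * R) : set (R * R) :=
  [set (1 - t) *: p + t *: q | t in `]0, 1[].

Definition boundary (A : set (R * R)) : set (R * R) :=
  closure A `\` interior A.

End Plane.

Section Drawings.
Variables (R : realType) (T : finType) (e : rel T) (pos : T -> R * R).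

Definition edge_segment (u v : T) : set (R * R) := segment (pos u) (pos v).

Definition drawing_set : set (R * R) :=
  [set x | (exists v, x = pos v) \/ (exists u v, e u v /\ edge_segment u v x)].

(* [drawing_set] is compact, so exactly one component of its complement is
   unbounded; the outer face is the set of points lying in it. *)
Definition outer_face : set (R * R) :=
  [set x | (~` drawing_set) x /\
           ~ bounded_set (connected_component (~` drawing_set) x)].

Definition is_OOR : Prop :=
  [/\ injective pos,
      forall u v w, e u v -> edge_segment u v (pos w) -> w = u \/ w = v &
      forall u v, u != v -> ~~ e u v ->
        exists x, edge_segment u v x /\ outer_face x].

Definition is_regular : Prop :=
  exists (c : R * R) (r theta : R) (s : T -> 'I_#|T|),
    [/\ 0 < r, bijective s &
        forall v, let phi := theta + 2 * pi * (s v)%:R / #|T|%:R in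
          pos v = (c.1 + r * cos phi, c.2 + r * sin phi)].

Definition planarization_vertex : set (R * R) :=
  [set x | (exists v, x = pos v) \/
           (exists u v u' v', [/\ e u v, e u' v', [set u; v]%SET != [set u'; v']%SET,
                                  edge_segment u v x & edge_segment u' v' x])].

(* In an OOR two distinct edges share at most one point (an overlap would put a
   vertex inside an edge), so each edge carries finitely many vertices of the
   planarization and is cut into segments between consecutive ones. *)
Definition subsegment (u v : T) (p q : R * R) : Prop :=
  [/\ p <> q,
      edge_segment u v p /\ planarization_vertex p,
      edge_segment u v q /\ planarization_vertex q &
      forall x, open_segment p q x -> ~ planarization_vertex x].

Definition is_reducible : Prop :=
  forall u v, e u v ->
    exists p q, subsegment u v p q /\ segment p q `<=` boundary outer_face.

End Drawings.

(* Main.v *)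
(** The vertices are put on the circle in a depth-first order: starting from one
    vertex, repeatedly insert the new vertices of a bridge or cycle through an
    already placed vertex w consecutively right after w. A cycle
    v_0 = w, v_1, ..., v_(k-1) is inserted in the zigzag order c_0 = v_0,
    c_1 = v_1, c_2 = v_(k-1), c_3 = v_2, c_4 = v_(k-2), ..., so that c_i is
    adjacent to c_(i+2) and, apart from that, only c_0 c_1 and c_(k-2) c_(k-1)
    are edges.

    Two consecutive non-adjacent positions p, q form a gap through which the
    outer face enters the polygon. A point lying, for every edge yz, strictly on
    the same side of the line yz as the midpoint of the gap is joined to that
    midpoint by a segment avoiding the drawing, hence lies in the outer face. Two
    vertices separated by a cut vertex w see the gap between the components of
    G - w placed around w. Two vertices of the same cycle with consecutive
    positions c_i, c_(i+1) see a gap between them, and all other pairs see, through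
    the center of the zigzag, the gap between c_(k-1) and c_0. An edge
    c_i c_(i+2) borders the center between its crossings with c_(i-1) c_(i+1) and
    c_(i+1) c_(i+3). Only the convex position of the vertices is used. *)
Require Import Defs.
From mathcomp Require Import all_boot all_order all_algebra.
From mathcomp Require Import all_classical all_reals all_analysis.
From mathcomp Require Import zify ring lra.
Import Order.TTheory GRing.Theory Num.Theory.
Import numFieldNormedType.Exports.

Set Implicit Arguments.
Unset Strict Implicit.
Unset Printing Implicit Defensive.

(** * Cycles of a cactus *)

Section Theta.
Variables (T : finType) (e : rel T).
Hypothesis e_sym : symmetric e.
Hypothesis e_cactus : cactus e.

Lemma cycle_edges_sub (c1 c2 : seq T) x :
  cycle_edges c1 = cycle_edges c2 -> x \in c1 -> x \in c2.
Proof.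
move=> E12 xc; have: [set x; next c1 x]%SET \in cycle_edges c1 by apply: imset_f.
rewrite E12 => /imsetP[y yc /setP/(_ x)]; rewrite !inE eqxx /=.
by move/esym/orP=> [/eqP->|/eqP->] //; rewrite mem_next.
Qed.

Lemma next_mid a (p1 p2 : seq T) b : uniq (a :: p1 ++ b :: p2) ->
  next (a :: p1 ++ b :: p2) b = head a p2.
Proof.
move=> U; rewrite -(next_rot (size (a :: p1)) U) -cat_cons rot_size_cat.
by case: p2 {U} => [|h p2] /=; rewrite eqxx.
Qed.

(** Replacing [p1] by the detour [P] gives a second cycle through the edge from [b] to its
    successor, so both cycles have the same edges and the same vertices. [P] avoids the first cycle,
    so it is empty, and then [p1] avoids the second. *)
Lemma theta a b (p1 p2 P : seq T) :
  ucycle e (a :: p1 ++ b :: p2) -> (2 < size (a :: p1 ++ b :: p2))%N ->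
  path e a (rcons P b) -> uniq P ->
  (forall x, x \in P -> x \notin a :: p1 ++ b :: p2) ->
  P = [::] /\ (p1 = [::] \/ p2 = [::]).
Proof.
set c1 := a :: p1 ++ b :: p2 => uc1 sz1 pP uP dP.
set c2 := a :: P ++ b :: p2.
have /andP[cyc1 u1] := uc1.
have u2 : uniq c2.
  move: u1; rewrite /c1 /c2 /= !cat_uniq /= !mem_cat !inE !negb_or uP.
  case/and5P=> /and3P[_ -> ->] _ _ -> -> /=.
  rewrite !andbT; apply/and3P; split.
  - by apply/negP=> /dP; rewrite inE eqxx.
  - by apply/negP=> /dP; rewrite !inE mem_cat inE eqxx !orbT.
  - apply/hasPn=> x xp; apply/negP=> /dP; rewrite !inE mem_cat inE xp.
    by rewrite !orbT.
have cyc2 : cycle e c2.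
  move: cyc1; rewrite /c1 /c2 /= !rcons_cat !cat_path /= => /and3P[_ _ ->].
  by move: pP; rewrite rcons_path => /andP[-> ->].
have uc2 : ucycle e c2 by apply/andP.
(* If [P] and [p2] are both empty, [c2] is [[:: a; b]], which is not a simple cycle: the detour is
   the closing edge of [c1]. *)
case: (boolP (nilp P && nilp p2)) => [/andP[/nilP-> /nilP->]|nn].
  by split; [|right].
have sz2 : (2 < size c2)%N.
  by move: nn; rewrite /nilp /c2 /= size_cat /=; lia.
have eb : e b (head a p2).
  by move: cyc2; rewrite /c2 /= rcons_cat cat_path /=; case: (p2) => [|? ?] /=;
    case/and3P=> // _ _ /andP[].
have b1 : [set b; head a p2]%SET \in cycle_edges c1.
  rewrite -(next_mid u1); apply: imset_f.
  by rewrite !inE mem_cat inE eqxx !orbT.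
have b2 : [set b; head a p2]%SET \in cycle_edges c2.
  rewrite -(next_mid u2); apply: imset_f.
  by rewrite !inE mem_cat inE eqxx !orbT.
have E12 := e_cactus.2 _ _ _ _ eb (conj uc1 sz1) (conj uc2 sz2) b1 b2.
have P0 : P = [::].
  case EP: P => [//|h t]; have hP : h \in P by rewrite EP mem_head.
  case/negP: (dP h hP); apply: (cycle_edges_sub (esym E12)).
  by rewrite inE mem_cat hP orbT.
split=> //; left; case Ep: p1 => [//|h t]; exfalso.
have : h \in c2.
  by apply: (cycle_edges_sub E12); rewrite /c1 Ep !inE eqxx orbT.
move: u1; rewrite /c1 /c2 P0 Ep /= !inE => /and3P[+ + _].
rewrite !mem_cat !inE !negb_or eq_sym => /andP[/negbTE->].
by move=> _ /and3P[_ /negbTE-> /negbTE->].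
Qed.

End Theta.

(** * Growing a union of blocks by a bridge or a cycle *)

Section Extension.
Variables (T : finType) (e : rel T).
Hypothesis e_sym : symmetric e.
Hypothesis e_irr : irreflexive e.
Hypothesis e_cactus : cactus e.

(** The form of [theta] by positions: rotating the cycle so that position [i] comes first turns its
    two arcs into [p1] and [p2]. *)
Lemma cycle_ear x0 (c : seq T) i j (P : seq T) :
  ucycle e c -> (2 < size c)%N -> (i < j < size c)%N ->
  path e (nth x0 c i) (rcons P (nth x0 c j)) -> uniq P ->
  (forall x, x \in P -> x \notin c) ->
  P = [::] /\ (j = i.+1 \/ i = 0%N /\ j.+1 = size c).
Proof.
move=> uc sz /andP[ij jc] pP uP dP.
have Ec : rot i c = nth x0 c i :: take (j - i.+1) (drop i.+1 c) ++
    nth x0 c j :: (drop j.+1 c ++ take i c).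
  rewrite /rot (drop_nth x0); last by lia.
  congr (_ :: _); rewrite -cat_cons catA; congr (_ ++ _).
  rewrite -[LHS](cat_take_drop (j - i.+1)) drop_drop; congr (_ ++ _).
  by rewrite subnK // -drop_nth.
have uc' : ucycle e (rot i c) by rewrite /ucycle rot_cycle rot_uniq.
have sz' : (2 < size (rot i c))%N by rewrite size_rot.
have dP' x : x \in P -> x \notin rot i c by move=> /dP; rewrite mem_rot.
move: uc' sz' dP'; rewrite Ec => uc' sz' dP'.
have [P0 Hp] := theta e_cactus uc' sz' pP uP dP'.
split=> //; case: Hp => /(congr1 size) /=; rewrite ?size_cat ?size_takel ?size_drop; lia.
Qed.

Lemma cycle_chord x0 (c : seq T) i j :
  ucycle e c -> (2 < size c)%N -> (i < j < size c)%N ->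
  e (nth x0 c i) (nth x0 c j) -> j = i.+1 \/ i = 0%N /\ j.+1 = size c.
Proof.
move=> uc sz ijc eij.
have eij' : path e (nth x0 c i) (rcons [::] (nth x0 c j)) by rewrite /= eij.
by case: (cycle_ear uc sz ijc eij').
Qed.

Lemma cycle_nthS x0 (c : seq T) i : cycle e c -> (i.+1 < size c)%N ->
  e (nth x0 c i) (nth x0 c i.+1).
Proof.
case: c => // a c /=; rewrite rcons_path => /andP[/pathP pc _].
by rewrite ltnS => /(pc x0).
Qed.

Lemma cycle_last x0 (c : seq T) : cycle e c ->
  (0 < size c)%N -> e (nth x0 c 0) (nth x0 c (size c).-1).
Proof.
case: c => // a c /=; rewrite rcons_path => /andP[_ ec] _.
by rewrite e_sym -last_nth.
Qed.

(* A cycle v_0 ... v_(k-1) is laid out as v_0 v_1 v_(k-1) v_2 v_(k-2) ... *)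
Definition zigzag k i := (if i == 0 then 0 else if odd i then i.+1./2 else k - i./2)%N.

Lemma zigzag_lt k i : (i < k)%N -> (zigzag k i < k)%N.
Proof. by rewrite /zigzag; case: eqP => [->|?] //; case: ifP => ?; lia. Qed.

Lemma zigzag_inj k i j : (i < k)%N -> (j < k)%N -> zigzag k i = zigzag k j -> i = j.
Proof.
rewrite /zigzag => ik jk; case: (i =P 0%N) => [->|?]; case: (j =P 0%N) => [->|?] //;
  by case: ifP => ?; try case: ifP => ?; lia.
Qed.

Lemma zigzag2 k i : (i.+2 < k)%N ->
  [\/ zigzag k i.+2 = (zigzag k i).+1, zigzag k i = (zigzag k i.+2).+1 |
      zigzag k i = 0%N /\ zigzag k i.+2 = k.-1].
Proof.
rewrite /zigzag /= negbK; case: eqP => [->|?] /= ik; first by constructor 3; lia.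
by case: ifP => ?; [constructor 1|constructor 2]; lia.
Qed.

(** The four exclusions are the forms of adjacency on the cycle, the last two for its closing
    edge. *)
Lemma zigzag_far k i j : (i.+3 <= j)%N -> (j < k)%N ->
  [/\ zigzag k j <> (zigzag k i).+1, zigzag k i <> (zigzag k j).+1,
      ~ (zigzag k i = 0%N /\ (zigzag k j).+1 = k) &
      ~ (zigzag k j = 0%N /\ (zigzag k i).+1 = k)].
Proof.
move=> ij jk; rewrite /zigzag; case: (j =P 0%N) => [?|?]; first lia.
by case: (i =P 0%N) => [?|?]; case: ifP => ?; try case: ifP => ?; split; lia.
Qed.

(** Consecutive positions are left open, as only the first and the last such pair are edges in a
    zigzag; for a bridge both conditions are vacuous. *)
Definition layout x0 (c : seq T) :=
  (forall i, (i.+2 < size c)%N -> e (nth x0 c i) (nth x0 c i.+2)) /\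
  (forall i j, (i.+3 <= j < size c)%N -> ~~ e (nth x0 c i) (nth x0 c j)).

Definition outrel (s : seq T) := [rel x y | [&& e x y, x \notin s & y \notin s]].

(* Every component of the graph minus [s] has at most one neighbour in [s]: this
   is the invariant that keeps [s] a union of blocks. *)
Definition one_attached (s : seq T) := forall a b x y,
  a \in s -> b \in s -> x \notin s -> y \notin s ->
  e a x -> connect (outrel s) x y -> e y b -> a = b.

Lemma outrel_sym s : symmetric (outrel s).
Proof. by move=> x y; rewrite /= e_sym [(x \notin s) && _]andbC. Qed.

Lemma outrel_connect_sub (s s' : seq T) : {subset s <= s'} ->
  subrel (connect (outrel s')) (connect (outrel s)).
Proof.
move=> ss'; apply: connect_sub => x y /= /and3P[exy xs ys]; apply: connect1.
by rewrite /= exy (contra (ss' _) xs) (contra (ss' _) ys).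
Qed.

Lemma outrel_path s x p : x \notin s -> path (outrel s) x p ->
  path e x p /\ {in x :: p, forall z, z \notin s}.
Proof.
elim: p x => [|y p IH] x xs /=; first by split=> // z; rewrite inE => /eqP->.
case/andP=> /and3P[exy _ ys] /(IH _ ys)[-> H]; rewrite exy; split=> // z.
by rewrite inE => /orP[/eqP->|/H].
Qed.

(** Here [x] is the only neighbour of [w] in its component outside [s]. If that component had
    another vertex with a neighbour in [s], the invariant would make that neighbour [w], and [w]
    would have a second neighbour in the component. *)
Lemma bridge_extension (s : seq T) w x : one_attached s ->
  w \in s -> x \notin s -> e w x ->
  (forall y, y \notin s -> e w y -> connect (outrel s) x y -> y = x) ->
  (forall y, y \in s -> e x y -> y = w) /\ one_attached (rcons s x).
Proof.
move=> cs ws xs ewx ux; have xw y : y \in s -> e x y -> y = w.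
  by move=> ys exy; rewrite (cs w y x x ws ys xs xs ewx (connect0 _ _) exy).
have sub : {subset s <= rcons s x} by move=> z; rewrite mem_rcons inE orbC => ->.
split=> // a b u v; rewrite !mem_rcons !inE !negb_or.
move=> + + /andP[ux' us] /andP[vx vs] eau cuv evb.
have cuv' := outrel_connect_sub sub cuv.
have key u' v' b' : u' \notin s -> v' \notin s -> v' != x -> e x u' -> connect (outrel s) u' v' ->
    e v' b' -> b' \in s -> False.
  move=> us' vs' vx' exu' c' ev' bs'.
  have cxv : connect (outrel s) x v'.
    by apply: connect_trans c'; apply: connect1; rewrite /= exu' xs us'.
  have wb := cs _ _ _ _ ws bs' xs vs' ewx cxv ev'.
  by move: vx'; rewrite (ux v') ?eqxx // wb e_sym.
case/orP=> [/eqP ax|as_]; case/orP=> [/eqP bx|bs]; subst => //.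
- by case: (key u v b).
- case: (key v u a) => //; rewrite 1?e_sym //.
  by rewrite (sym_connect_sym (@outrel_sym s)).
- exact: (cs a b u v).
Qed.

(** The path [x :: p] and [w] form a cycle, and [D] is its zigzag order without [w]. An outside
    component touching the cycle at two vertices would give an ear, which a cactus excludes. *)
Lemma cycle_extension (s : seq T) w x p :
  one_attached s -> w \in s -> x \notin s -> e w x ->
  path (outrel s) x p -> uniq (x :: p) -> p <> [::] -> e (last x p) w ->
  exists D : seq T,
  [/\ [/\ D <> [::], uniq D & forall y, y \in D -> y \notin s],
      forall x y, x \in D -> y \in s -> e x y -> y = w,
      one_attached (s ++ D) & layout w (w :: D)].
Proof.
move=> cs ws xs ewx pp up pn0 elw.
have [pe ps] := outrel_path xs pp.
set c := w :: x :: p.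
have cyc : cycle e c by rewrite /c /= ewx rcons_path pe.
have uc : ucycle e c.
  by rewrite /ucycle cyc /= -/(uniq (x :: p)) up andbT; apply/negP=> /ps; rewrite ws.
have sz : (2 < size c)%N by rewrite /c /=; case: (p) pn0.
have [k Ek] : {k | size c = k} by exists (size c).
have kE : k = (size p).+2 by rewrite -Ek.
(* Zigzag index [0] is [w] itself, so [D] starts at index [1]. *)
pose D := mkseq (fun i => nth w c (zigzag k i.+1)) k.-1.
have nthD i : (i < k)%N -> nth w (w :: D) i = nth w c (zigzag k i).
  by case: i => [|i] ik //=; rewrite nth_mkseq //; lia.
have sD : size D = k.-1 by rewrite size_mkseq.
have uD : uniq D.
  rewrite map_inj_in_uniq ?iota_uniq // => i j; rewrite !mem_iota => /= ik jk.
  move/eqP; rewrite nth_uniq; [|rewrite Ek; apply: zigzag_lt; lia ..|by case/andP: uc].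
  by move/eqP/zigzag_inj; lia.
have subD : {subset D <= x :: p}.
  move=> y /mapP[i]; rewrite mem_iota /= => ik ->.
  have zk : (zigzag k i.+1 < k)%N by apply: zigzag_lt; lia.
  have z0 : zigzag k i.+1 <> 0%N.
    move=> z0; have E : zigzag k i.+1 = zigzag k 0 by []; have := zigzag_inj _ _ E; lia.
  by case: zigzag zk z0 => // m; rewrite kE /c /= !ltnS => mk _; apply: mem_nth.
have Dp : D =i x :: p.
  by apply: (uniq_min_size uD subD _).2; rewrite sD kE.
have conn y : y \in x :: p -> connect (outrel s) x y.
  by move=> yp; apply/connectP; case/splitPl: yp pp => p1 p2 <-; 
    rewrite cat_path => /andP[]; exists p1.
have csym := sym_connect_sym (@outrel_sym s).
have Dw z y : z \in D -> y \in s -> e z y -> y = w.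
  rewrite Dp => zp ys ezy; apply/esym.
  exact: (cs w y x z ws ys xs (ps _ zp) ewx (conn _ zp) ezy).
exists D; split=> //.
- split=> //; last by move=> y; rewrite Dp => /ps.
  by move=> D0; move: sD; rewrite D0 kE.
- have sub : {subset s <= s ++ D} by move=> z; rewrite mem_cat => ->.
  have inc z : z \in D -> z \in c by rewrite Dp => zp; rewrite inE zp orbT.
  move=> a b u v; rewrite !mem_cat !negb_or => ha hb /andP[us uD'] /andP[vs vD] eau cuv evb.
  have cuv' := outrel_connect_sub sub cuv.
  have cycle_case : a \in c -> b \in c -> a = b.
    move=> ac bc; apply/eqP/negP => /negP nab.
    have out z : z \notin s ++ D -> z \notin c.
      rewrite mem_cat negb_or Dp => /andP[zs zp]; rewrite inE negb_or zp andbT.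
      by apply: contra zs => /eqP->.
    have ear a' b' u' v' : a' \in c -> b' \in c -> u' \notin s ++ D -> e a' u' ->
        connect (outrel (s ++ D)) u' v' -> e v' b' -> (index a' c < index b' c)%N -> False.
      move=> a'c b'c u'o eau' /connectP[q0 pq0 ->] evb'.
      case/shortenP: pq0 evb' => q pq uq _ evb' lab.
      have [eq qo] := outrel_path u'o pq.
      have pq' : path e (nth w c (index a' c)) (rcons (u' :: q) (nth w c (index b' c))).
        by rewrite !nth_index //= eau' rcons_path eq.
      have [|//] := cycle_ear uc sz _ pq' uq (fun z zq => out z (qo z zq)).
      by rewrite lab index_mem.
    have uo : u \notin s ++ D by rewrite mem_cat negb_or us.
    have vo : v \notin s ++ D by rewrite mem_cat negb_or vs.
    case: (ltngtP (index a c) (index b c)) => [lt|lt|E].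
    - exact: (ear a b u v).
    - apply: (ear b a v u) => //; rewrite 1?e_sym //.
      by rewrite (sym_connect_sym (@outrel_sym (s ++ D))).
    - by rewrite -(nth_index w ac) E nth_index ?eqxx in nab.
  (* [b'] lies in the component of [x] outside [s], which is attached at [w]; hence the invariant
     for [s] forces [a' = w], a vertex of the cycle. *)
  have mixed a' b' u' v' : a' \in s -> b' \in D -> u' \notin s -> v' \notin s ->
      e a' u' -> connect (outrel s) u' v' -> e v' b' -> a' = w.
    move=> a's; rewrite Dp => b'D u's v's eau' cuv2 evb'.
    apply: (cs a' w u' x) => //; last by rewrite e_sym.
    apply: connect_trans cuv2 _; rewrite csym; apply: connect_trans (conn _ b'D) _.
    by apply: connect1; rewrite /= e_sym evb' v's ps.
  case/orP: ha => [as_|aD]; case/orP: hb => [bs|bD].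
  + exact: (cs a b u v).
  + apply: cycle_case; last exact: inc.
    by rewrite (mixed a b u v) // inE eqxx.
  + apply: cycle_case; first exact: inc.
    by rewrite (mixed b a v u) ?inE ?eqxx // 1?e_sym // csym.
  + by apply: cycle_case; apply: inc.
- have swD : size (w :: D) = k by rewrite /= sD kE.
  split=> [i|i j]; rewrite swD => ik.
    rewrite !nthD //; last by lia.
    have z2 := zigzag_lt ik; have z0 : (zigzag k i < k)%N by apply: zigzag_lt; lia.
    case: (zigzag2 ik) => [E|E|[-> ->]]; last by rewrite -Ek; apply: cycle_last.
    + by rewrite E; apply: cycle_nthS => //; rewrite -E Ek.
    + by rewrite E e_sym; apply: cycle_nthS => //; rewrite -E Ek.
  have [ij jk] := andP ik; rewrite !nthD //; last by lia.
  have zj := zigzag_lt jk; have zi : (zigzag k i < k)%N by apply: zigzag_lt; lia.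
  have [f1 f2 f3 f4] := zigzag_far ij jk.
  apply/negP=> ez; case: (ltngtP (zigzag k i) (zigzag k j)) => [lt|lt|E].
  + have lt' : (zigzag k i < zigzag k j < size c)%N by rewrite lt Ek.
    by case: (cycle_chord uc sz lt' ez) => // -[h1 h2]; apply: f3; rewrite h2 Ek.
  + have lt' : (zigzag k j < zigzag k i < size c)%N by rewrite lt Ek.
    by rewrite e_sym in ez; case: (cycle_chord uc sz lt' ez) => // -[h1 h2]; apply: f4; rewrite h2 Ek.
  + by rewrite E e_irr in ez.
Qed.

End Extension.

(** * Block orders *)

(* [a 0 < ... < a (k-1)] are the positions of the vertices of a block (or a
   single cut vertex when [k = 1]); everything hanging off [a i] sits in the
   interval from [a i] to [a i.+1], and [a k] is the end of the last interval. *)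
Definition block (E : rel nat) n k (a : nat -> nat) :=
  [/\ (0 < k)%N, forall i, (i < k)%N -> (a i < a i.+1)%N, (a k <= n)%N &
   forall y z, (y < z < n)%N -> E y z ->
     [\/ exists i j, [/\ (i < j < k)%N, (j <= i.+2)%N, y = a i & z = a j],
         exists i, (i < k)%N /\ (a i <= y)%N && (z < a i.+1)%N |
         ((y <= a 0) || (a k <= y))%N /\ ((z <= a 0) || (a k <= z))%N]].

(** With [k = 1] the positions strictly between [a 0] and [a 1] form a union of components of the
    graph minus [a 0]; exactly one of [u], [v] is among them, and neither is [a 0]. *)
Definition cut_apart (E : rel nat) n u v := exists a,
  block E n 1 a /\
  ((a 0 < u < a 1)%N /\ (a 1 <= v)%N \/ (u < a 0)%N /\ (a 0 < v < a 1)%N).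

Definition coblock (E : rel nat) n u v := exists k a,
  [/\ block E n k a, forall i, (i.+2 < k)%N -> E (a i) (a i.+2) &
      exists i j, [/\ (i < j < k)%N, u = a i & v = a j]].

(** The combinatorial property of a vertex order from which both the visibility of non-edges and
    reducibility are derived. *)
Definition block_order (E : rel nat) n := forall u v, (u < v < n)%N ->
  cut_apart E n u v \/ coblock E n u v.

Lemma block_lt E n k a i j : block E n k a -> (i < j <= k)%N -> (a i < a j)%N.
Proof.
case=> _ ai _ _ /andP[ij jk]; elim: j ij jk => // j IH ij jk.
case: (ltngtP i j) => h; [|lia|by rewrite h; apply: ai].
exact: (ltn_trans (IH h (ltnW jk)) (ai _ jk)).
Qed.

(** * Inserting new positions after a placed vertex *)

Section Shift.
Variables (i0 m : nat).

Definition shift x := if (x <= i0)%N then x else (x + m)%N.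

Lemma shift_small x : (x <= i0)%N -> shift x = x.
Proof. by rewrite /shift => ->. Qed.

Lemma shift_big x : (i0 < x)%N -> shift x = (x + m)%N.
Proof. by rewrite /shift; case: leqP. Qed.

Lemma shift_out x : (shift x <= i0)%N || (i0 + m < shift x)%N.
Proof. by case: (leqP x i0) => h; [rewrite shift_small ?h|rewrite shift_big ?ltn_add2r ?h ?orbT]. Qed.

Lemma shift_lt x y : (shift x < shift y)%N = (x < y)%N.
Proof. by rewrite /shift; case: ifP => ?; case: ifP => ?; apply/idP/idP; lia. Qed.

Lemma shift_le x y : (shift x <= shift y)%N = (x <= y)%N.
Proof. by rewrite leqNgt shift_lt -leqNgt. Qed.

Variables (E E' : rel nat) (n : nat).
Hypothesis i0n : (i0 < n)%N.
Hypothesis EE' : forall y z, (y < z < n + m)%N -> E' y z ->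
  (exists y0 z0, [/\ (y0 < z0 < n)%N, E y0 z0, y = shift y0 & z = shift z0]) \/
  (i0 <= y)%N /\ (z <= i0 + m)%N.

(** If [i0] falls into an interval of the block, that interval absorbs the edges between [i0] and
    [i0 + m]; otherwise these edges lie entirely before or after the block. *)
Lemma block_shift k a : block E n k a -> block E' (n + m) k (shift \o a).
Proof.
case=> k0 ai akn aE; split=> //= [i /ai|| y z yz].
- by rewrite shift_lt.
- by rewrite /shift; case: ifP; lia.
case/(EE' yz) => [[y0 [z0 [yz0 E0 -> ->]]]|[iy zi]].
  case: (aE y0 z0 yz0 E0) => [[i [j [ijk ji -> ->]]]|[i [ik H]]|H].
  - by constructor 1; exists i, j.
  - by constructor 2; exists i; rewrite shift_le shift_lt.
  - by constructor 3; rewrite !shift_le.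
case: (leqP (a 0) i0) => h0; last by constructor 3; rewrite /= shift_big //; lia.
case: (leqP (a k) i0) => hk; first by constructor 3; rewrite /= [shift (a k)]shift_small //; lia.
constructor 2.
have [i [ik ai1 ai2]] : exists i, [/\ (i < k)%N, (a i <= i0)%N & (i0 < a i.+1)%N].
  elim: (k) hk {k0 ai akn aE} => [|k' IH] hk; first lia.
  case: (leqP (a k') i0) => h; first by exists k'.
  by have [i [? ? ?]] := IH h; exists i; split=> //; lia.
by exists i; split=> //=; rewrite shift_small // shift_big //; lia.
Qed.

End Shift.

Section Insert.
Variables (T : finType) (e : rel T) (x0 : T).
Hypothesis e_sym : symmetric e.

Definition pos_rel (s : seq T) : rel nat := [rel i j | e (nth x0 s i) (nth x0 s j)].

Lemma pos_relE s i j : pos_rel s i j = e (nth x0 s i) (nth x0 s j).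
Proof. by []. Qed.

Variables (s1 s2 : seq T) (w : T) (D : seq T).
Let s := s1 ++ w :: s2.
Let s' := s1 ++ w :: D ++ s2.
Let i0 := size s1.
Let m := size D.

Lemma nth_shift i : (i < size s)%N -> nth x0 s' (shift i0 m i) = nth x0 s i.
Proof.
rewrite /s /s' size_cat /= => ik; rewrite nth_cat [RHS]nth_cat.
case: (leqP i i0) => h.
  rewrite shift_small //; case: ltnP => // h'.
  by have -> : (i - size s1 = 0)%N by rewrite /i0 in h; lia.
rewrite shift_big // -cat_cons nth_cat /=; rewrite /i0 in h.
case: ltnP => [|_]; first lia.
case: ltnP => [|_]; first by rewrite /m; lia.
case: ltnP => [|_]; first lia.
have -> : (i - size s1 = (i - (size s1).+1).+1)%N by lia.
by congr nth; rewrite /m; lia.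
Qed.

Lemma nth_inserted j : (j <= m)%N -> nth x0 s' (i0 + j) = nth w (w :: D) j.
Proof.
move=> jm; rewrite (set_nth_default x0); last by rewrite /= ltnS.
rewrite /s' nth_cat ltnNge leq_addr /= addKn -cat_cons nth_cat.
by rewrite /= ltnS jm.
Qed.

Lemma size_insert : size s' = (size s + m)%N.
Proof. by rewrite /s /s' !size_cat /= size_cat; lia. Qed.

Lemma shift_or y : (y < size s')%N ->
  (exists2 y0, (y0 < size s)%N & y = shift i0 m y0) \/
  exists j, (j < m)%N /\ y = (i0 + j.+1)%N.
Proof.
rewrite size_insert /shift => ys.
have i0s : (i0 < size s)%N by rewrite size_cat /=; lia.
case: (leqP y i0) => h; first by left; exists y; rewrite ?h //; lia.
case: (leqP y (i0 + m)) => h'.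
  by right; exists (y - i0).-1; split; lia.
by left; exists (y - m)%N; [lia|case: ifP; lia].
Qed.

Hypothesis s_uniq : uniq s.
Hypothesis D_attach : forall x y, x \in D -> y \in s -> e x y -> y = w.
Hypothesis D_layout : layout e w (w :: D).
Hypothesis s_order : block_order (pos_rel s) (size s).

Lemma insert_edges y z : (y < z < size s + m)%N -> pos_rel s' y z ->
  (exists y0 z0, [/\ (y0 < z0 < size s)%N, pos_rel s y0 z0, y = shift i0 m y0 & z = shift i0 m z0]) \/
  (i0 <= y)%N /\ (z <= i0 + m)%N.
Proof.
rewrite -size_insert => /andP[yz zs] yz'; have ys := ltn_trans yz zs.
have new j y0 : (j < m)%N -> (y0 < size s)%N -> e (nth x0 s' (i0 + j.+1)) (nth x0 s y0) -> y0 = i0.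
  move=> jm y0s; rewrite nth_inserted //= => /D_attach -/(_ (mem_nth _ jm) (mem_nth _ y0s)).
  move=> E0; apply/eqP; rewrite -(nth_uniq x0 y0s _ s_uniq) ?E0; last first.
    by rewrite /s size_cat /= /i0; lia.
  by rewrite /s /i0 nth_cat ltnn subnn.
have si : shift i0 m i0 = i0 by rewrite /shift leqnn.
case: (shift_or ys) => [[y0 y0s Ey]|[j [jm Ey]]];
  case: (shift_or zs) => [[z0 z0s Ez]|[l [lm Ez]]].
- left; exists y0, z0; split=> //; first by rewrite z0s andbT -(shift_lt i0 m) -Ey -Ez.
  by move: yz'; rewrite !pos_relE Ey Ez !nth_shift.
- right; move: yz'; rewrite !pos_relE Ey Ez nth_shift // e_sym => /new -> //.
  by rewrite si; lia.
- right; move: yz'; rewrite !pos_relE Ey Ez nth_shift // => /new E0.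
  by move: yz; rewrite Ey Ez E0 // si; lia.
- by right; lia.
Qed.

(** Old pairs keep their witness after shifting, pairs in [w :: D] belong to the new block, and [w]
    separates every other old vertex from the new ones. *)
Lemma block_order_insert : block_order (pos_rel s') (size s').
Proof.
have i0s : (i0 < size s)%N by rewrite /s size_cat /= /i0; lia.
rewrite size_insert => u v uv; have [uv1 vs] := andP uv.
have us := ltn_trans uv1 vs.
rewrite -size_insert in us vs.
have old_out := shift_out i0 m.
(* The inserted vertices as the interval of the cut vertex [w]: the function is [i0] at [0] and
   [i0 + m.+1] at [1]. *)
have w_block : block (pos_rel s') (size s + m) 1 (fun i => i0 + i * m.+1)%N.
  split=> //; [by case=> [|i] // _; lia|lia|].
  move=> y z yz /(insert_edges yz)[[y0 [z0 [_ _ -> ->]]]|[iy zi]].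
    by constructor 3; move: (old_out y0) (old_out z0); lia.
  by constructor 2; exists 0%N; lia.
(* The new block [w :: D]: nothing hangs off its vertices yet, so each interval is a single
   position. *)
have D_coblock i j : (i < j <= m)%N -> coblock (pos_rel s') (size s + m) (i0 + i) (i0 + j).
  move=> ij; exists m.+1, (addn i0); split.
  - split=> // [l||y z yz]; [lia|lia|].
    move=> E; case: (insert_edges yz E) => [[y0 [z0 [_ _ -> ->]]]|[iy zi]].
      by constructor 3; move: (old_out y0) (old_out z0); lia.
    constructor 1; exists (y - i0)%N, (z - i0)%N; split; [lia| |lia|lia].
    rewrite leqNgt; apply/negP => far.
    have [_ /(_ (y - i0)%N (z - i0)%N)] := D_layout.
    rewrite -!nth_inserted; [|lia|lia].
    have -> : (i0 + (y - i0) = y)%N by lia.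
    have -> : (i0 + (z - i0) = z)%N by lia.
    by move=> H; apply: (negP (H _)); last exact: E; move=> /=; rewrite -/m; lia.
  - move=> l lm; rewrite pos_relE !nth_inserted; [|lia|lia].
    by apply: D_layout.1.
  - by exists i, j; split=> //; lia.
case: (shift_or us) => [[u0 u0s Eu]|[j [jm Eu]]];
  case: (shift_or vs) => [[v0 v0s Ev]|[l [lm Ev]]].
- have uv0 : (u0 < v0 < size s)%N by rewrite v0s andbT -(shift_lt i0 m) -Eu -Ev.
  case: (s_order uv0) => [[a [ab H]]|[k [a [ab aE [i [j [ijk ai aj]]]]]]].
    left; exists (shift i0 m \o a); split; first exact: (block_shift i0s insert_edges ab).
    by rewrite Eu Ev /= !shift_lt !shift_le.
  right; exists k, (shift i0 m \o a); split.
  + exact: (block_shift i0s insert_edges ab).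
  + move=> l lk; have [_ _ ak _] := ab.
    have l1 : (a l < a k)%N by apply: (block_lt ab); lia.
    have l2 : (a l.+2 < a k)%N by apply: (block_lt ab); lia.
    by rewrite pos_relE !nth_shift; [apply: aE|lia|lia].
  + by exists i, j; rewrite Eu Ev ai aj.
- case: (ltngtP u0 i0) => h.
  + left; exists (fun i => i0 + i * m.+1)%N; split=> //; right.
    by rewrite Eu Ev shift_small; lia.
  + by move: uv1; rewrite Eu Ev shift_big; lia.
  + right; have := D_coblock 0%N l.+1; rewrite Eu Ev h shift_small // addn0.
    by apply; lia.
- left; exists (fun i => i0 + i * m.+1)%N; split=> //; left.
  by move: uv1 (old_out v0); rewrite Eu Ev; lia.
- by right; rewrite Eu Ev; apply: D_coblock; lia.
Qed.

End Insert.

(** * The depth-first order of a cactus *)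

Section Order.
Variables (T : finType) (e : rel T).
Hypothesis e_sym : symmetric e.
Hypothesis e_irr : irreflexive e.
Hypothesis e_cactus : cactus e.

Lemma one_attached_eq (s s' : seq T) : s =i s' -> one_attached e s -> one_attached e s'.
Proof.
move=> ss' cs a b x y; rewrite -!ss' => as_ bs xs ys eax cxy.
apply: (cs a b x y) => //; apply: outrel_connect_sub cxy.
by move=> z; rewrite ss'.
Qed.

(** If [w] has a second neighbour in the component of [x] outside [s], a path between the two closes
    a cycle through [w]; otherwise [x] is added alone. *)
Lemma extension (s : seq T) w x : one_attached e s ->
  w \in s -> x \notin s -> e w x ->
  exists D : seq T,
  [/\ [/\ D <> [::], uniq D & forall y, y \in D -> y \notin s],
      forall x y, x \in D -> y \in s -> e x y -> y = w,
      one_attached e (s ++ D) & layout e w (w :: D)].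
Proof.
move=> cs ws xs ewx.
case: (boolP [exists y, [&& y != x, y \notin s, e w y & connect (outrel e s) x y]]).
  case/existsP=> y /and4P[yx ys ewy /connectP[q pq Ey]].
  rewrite Ey in yx ewy; case/shortenP: pq yx ewy => p pp up _ yx ewy.
  apply: (@cycle_extension _ _ _ _ _ s w x p) => //; last by rewrite e_sym.
  by move=> p0; rewrite p0 /= eqxx in yx.
rewrite negb_exists => /forallP nex.
have [|Dw co] := bridge_extension e_sym cs ws xs ewx.
  move=> y ys ewy cxy; apply/eqP; apply: contraNT (nex y) => yx.
  by rewrite yx ys ewy cxy.
exists [:: x]; split=> //.
- by split=> // y; rewrite inE => /eqP->.
- by move=> z y; rewrite inE => /eqP->; apply: Dw.
- by rewrite cats1.
- by split=> [i|i j] //=; case: j => [|[|j]] //=; rewrite ?andbF // => /andP[_].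
Qed.

Lemma cactus_block_order (x0 : T) : exists s : seq T,
  [/\ uniq s, forall x, x \in s & block_order (pos_rel e x0 s) (size s)].
Proof.
suff H n (s : seq T) : (#|T| - size s <= n)%N -> x0 \in s -> uniq s ->
    one_attached e s -> block_order (pos_rel e x0 s) (size s) ->
    exists s : seq T, [/\ uniq s, forall x, x \in s & block_order (pos_rel e x0 s) (size s)].
  apply: (H #|T| [:: x0]); rewrite ?inE ?leq_subr //.
  - by move=> a b x y; rewrite !inE => /eqP-> /eqP->.
  - by move=> u v /= /andP[]; case: v.
elim: n s => [|n IH] s sn x0s us cs bo.
  exists s; split=> // x; apply/negPn/negP => xs.
  have /card_uniqP sxs : uniq (x :: s) by rewrite /= xs.
  have : ((size s).+1 <= #|T|)%N by rewrite -[(size s).+1]/(size (x :: s)) -sxs max_card.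
  by move: sn; rewrite leqn0 subn_eq0 leqNgt => /negP.
case: (boolP [forall x, x \in s]) => [/forallP|]; first by exists s.
rewrite negb_forall => /existsP[y ys].
(* The first edge leaving [s] on a path from [x0] to the unplaced vertex [y]. *)
have [w [x [ws xs ewx]]] : exists w x, [/\ w \in s, x \notin s & e w x].
  have /connectP[p pp Ey] := e_cactus.1 x0 y.
  elim: p (x0) x0s pp Ey => [|z p IHp] a as_ /=; first by move=> _ Ey; rewrite Ey as_ in ys.
  case/andP=> eaz pz Ey; case: (boolP (z \in s)) => zs; first exact: IHp Ey.
  by exists a, z.
have [D [[D0 uD dD] Dw co lay]] := extension cs ws xs ewx.
case/splitPr: s / ws {ys} sn x0s us cs bo dD Dw co xs => s1 s2 sn x0s us cs bo dD Dw co xs.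
have Eq : s1 ++ w :: D ++ s2 =i (s1 ++ w :: s2) ++ D.
  by move=> z; rewrite !(mem_cat, inE); do !case: (_ \in _); rewrite ?orbT ?orbF.
apply: (IH (s1 ++ w :: D ++ s2)).
- move: sn; rewrite !size_cat /= size_cat; case: (D) D0 => //= *; lia.
- by rewrite Eq mem_cat x0s.
- have : uniq ((s1 ++ w :: s2) ++ D).
    by rewrite cat_uniq us uD andbT; apply/hasPn => z /dD.
  congr is_true; apply: perm_uniq.
  by rewrite -catA perm_cat2l /= perm_cons perm_catC.
- by apply: one_attached_eq co => z; rewrite Eq.
- exact: (block_order_insert e_sym us Dw lay bo).
Qed.

End Order.

(** * Sides of the edges relative to a gap *)

(* Position [l] lies outside ([b = true]) or inside the arc from [y] to [z], ends included. *)
Definition side (b : bool) y z l := if b then (l <= y)%N || (z <= l)%N else (y <= l <= z)%N.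

Lemma side_total y z l : side (~~ (y <= l <= z)%N) y z l.
Proof.
rewrite /side; case: (boolP (y <= l <= z)%N) => //=.
by rewrite negb_and -!ltnNge => /orP[] /ltnW ->; rewrite ?orbT.
Qed.

Definition succ_mod n p q := (q = p.+1 /\ (q < n)%N) \/ (p.+1 = n /\ q = 0%N).

Section BlockSides.
Variables (E : rel nat) (n k : nat) (a : nat -> nat).
Hypothesis aB : block E n k a.

Lemma block_le i j : (i <= j <= k)%N -> (a i <= a j)%N.
Proof.
case/andP; rewrite leq_eqVlt => /orP[/eqP->//|ij] jk; apply: ltnW; apply: (block_lt aB).
by rewrite ij.
Qed.

Let p := (a k).-1.
Let q := if (a k < n)%N then a k else 0%N.

(* The gap after the last interval of the block, cyclically just before the
   component of [a 0]. *)
Lemma end_gap : succ_mod n p q.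
Proof.
have [k0 _ akn _] := aB; have ak0 : (a 0 < a k)%N by apply: (block_lt aB); lia.
by rewrite /p /q /succ_mod; case: (ltnP (a k) n); lia.
Qed.

(** Edges pass between the inside and the outside of the interval only at [a 0], so no edge
    separates [a 0] from the gap or is the gap. The last two hypotheses provide a vertex outside the
    interval and one inside it besides [a 0]. *)
Lemma cut_sides y z : k = 1%N -> (y < z < n)%N -> E y z -> (a 1 < n)%N || (0 < a 0)%N ->
  (a 0 < p)%N -> exists b, [/\ side b y z (a 0), side b y z p, side b y z q,
    ~ (p = y /\ q = z) & ~ (p = z /\ q = y)].
Proof.
move=> k1 yz Eyz out; have [k0 _ akn aE] := aB; have gq := end_gap.
rewrite /p /q in gq *; rewrite k1 in gq akn aE *; move=> pa.
case: (aE y z yz Eyz) => [[i [j [ij _ _ _]]]|[i [i0 h]]|h]; first lia.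
- have Ei : i = 0%N by lia.
  rewrite Ei in h; exists true; rewrite /side; case: (ltnP (a 1) n) out => h' /= out; split; lia.
- exists (~~ ((y <= a 0) && (a 1 <= z))%N); rewrite /side.
  by case: (ltnP (a 1) n) out => h' /= out; case: ifP => h''; split; lia.
Qed.

Lemma short_gap i : (i.+1 < k)%N -> succ_mod n (a i.+1).-1 (a i.+1).
Proof.
move=> ik; have [_ ai akn _] := aB; left; have := ai i (ltnW ik).
have : (a i.+1 < a k)%N by apply: (block_lt aB); lia.
by lia.
Qed.

(** A block edge has the gap in its arc exactly when it spans the step from [i] to [i.+1]; any other
    edge stays inside one interval or outside the block, up to the vertex [a 0]. *)
Lemma short_sides i y z : (i.+1 < k)%N -> (y < z < n)%N -> E y z ->
  ~ (y = a i /\ z = a i.+1) ->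
  exists b, [/\ side b y z (a i), side b y z (a i.+1).-1, side b y z (a i.+1) &
    ~ ((a i.+1).-1 = y /\ a i.+1 = z)].
Proof.
move=> ik yz Eyz nyz; have [_ ai akn aE] := aB.
have ai1 := ai i (ltnW ik).
have a0i : (a 0 <= a i)%N by apply: block_le; lia.
have aik : (a i.+1 < a k)%N by apply: (block_lt aB); lia.
case: (aE y z yz Eyz) => [[i' [j [ij jk Ey Ez]]]|[i' [ik' h]]|h].
- exists (~~ ((i' <= i) && (i < j)))%N.
  have [h1|h1] := leqP i' i; have [h2|h2] := ltnP i j; rewrite /side /=; last lia.
  + have : (a i' <= a i)%N by apply: block_le; lia.
    have : (a i.+1 <= a j)%N by apply: block_le; lia.
    by move=> ? ?; split; lia.
  + have : (a j <= a i)%N by apply: block_le; lia.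
    by move=> ?; split; lia.
  + have : (a i.+1 <= a i')%N by apply: block_le; lia.
    by move=> ?; split; lia.
- exists true; rewrite /side; case: (ltngtP i' i) => h'.
  + have : (a i'.+1 <= a i)%N by apply: block_le; lia.
    by move=> ?; split; lia.
  + have : (a i.+1 <= a i')%N by apply: block_le; lia.
    by move=> ?; split; lia.
  + by rewrite h' in h; split; lia.
- exists (~~ ((y <= a 0) && (a k <= z))%N); rewrite /side.
  by case: ifP => h'; split; lia.
Qed.

(** Edges of other blocks do not separate block vertices from the end gap. A block edge has at most
    one block vertex between its ends, and only this one can be cut off. *)
Lemma end_sides y z : (1 < k)%N -> (y < z < n)%N -> E y z ->
  exists b, [/\ side b y z p, side b y z q,
    (p = y /\ q = z) \/ (p = z /\ q = y) -> y = a 0 /\ z = a k.-1 &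
    forall i, (i < k)%N -> side b y z (a i) \/
      b /\ exists i', [/\ i = i'.+1, (i'.+2 < k)%N, y = a i' & z = a i'.+2]].
Proof.
move=> k1 yz Eyz; have [_ ai akn aE] := aB; have gq := end_gap; rewrite /p /q in gq *.
have k'k : k.-1.+1 = k by lia.
have lastk : (a k.-1 < a k)%N by rewrite -{2}k'k; apply: ai; lia.
have a0 : (a 0 < a k.-1)%N by apply: (block_lt aB); lia.
have a0i i : (i < k)%N -> (a 0 <= a i)%N by move=> ?; apply: block_le; lia.
have aik i : (i < k)%N -> (a i <= a k.-1)%N by move=> ?; apply: block_le; lia.
case: (aE y z yz Eyz) => [[i' [j [ij jk Ey Ez]]]|[i' [ik' h]]|h].
- have h0 := a0i i' (_ : i' < k)%N; have hk := aik j (_ : j < k)%N.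
  have {}h0 : (a 0 <= y)%N by rewrite Ey h0 //; lia.
  have {}hk : (z <= a k.-1)%N by rewrite Ez hk //; lia.
  exists true; rewrite /side; split; [lia|by case: ifP; lia|by case: ifP => ?; lia|].
  move=> i ik; have [h1|h1] := leqP i i'.
    by left; have := block_le (_ : i <= i' <= k)%N; rewrite Ey; lia.
  have [h2|h2] := leqP j i.
    by left; have := block_le (_ : j <= i <= k)%N; rewrite Ez; lia.
  right; split=> //; exists i'; have Ej : j = i'.+2 by lia.
  by rewrite -Ej; split=> //; lia.
- exists true; rewrite /side.
  have h0 := a0i i' ik'; have h1 : (a i'.+1 <= a k)%N by apply: block_le; lia.
  have h2 : (i' < k.-1)%N -> (a i'.+1 <= a k.-1)%N by move=> ?; apply: block_le; lia.
  have h3 : i' = k.-1 -> (a 0 < y)%N by move=> Ei; rewrite Ei in h; lia.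
  split; [lia|by case: ifP; lia|by case: ifP; lia|].
  move=> i ik; left; have [h4|h4] := leqP i i'.
    by have := block_le (_ : i <= i' <= k)%N; lia.
  by have := block_le (_ : i'.+1 <= i <= k)%N; lia.
- exists (~~ ((y <= a 0) && (a k <= z))%N); rewrite /side.
  split.
  + by case: ifP => h'; lia.
  + by case: ifP => h'; case: ifP; lia.
  + by case: ifP; lia.
  + by move=> i ik; left; have := a0i i ik; have := aik i ik; case: ifP; lia.
Qed.

Lemma block_inj i j : (i < k)%N -> (j < k)%N -> a i = a j -> i = j.
Proof.
move=> ik jk Eij; have lt x y : (x < y <= k)%N -> (a x < a y)%N := block_lt aB.
by case: (ltngtP i j) => // h; [have := lt i j|have := lt j i]; rewrite Eij ltnn; lia.
Qed.

Lemma block_edge i j : E (a i) (a j) -> (i < j < k)%N -> (j <= i.+2)%N.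
Proof.
move=> Eij ijk; have [_ ai akn aE] := aB.
have lt x y : (x < y <= k)%N -> (a x < a y)%N := block_lt aB.
have ij : (a i < a j)%N by apply: lt; lia.
have jn : (a j < a k)%N by apply: lt; lia.
have a0j : (a 0 < a j)%N by apply: lt; lia.
case: (aE (a i) (a j)) => // [|[i' [j' [ij' jk' Ei Ej]]]|[i' [ik' h]]|h]; first lia.
- have Eii : i = i' by apply: block_inj Ei; lia.
  have Ejj : j = j' by apply: block_inj Ej; lia.
  by rewrite Eii Ejj.
- have [h1|h1] := leqP i' i; last first.
    have : (a i < a i')%N by apply: lt; lia.
    by case/andP: h => h _; rewrite ltnNge h.
  have : (a i'.+1 <= a j)%N by apply: block_le; lia.
  by case/andP: h => _ h; rewrite leqNgt h.
- by case: h => _; rewrite leqNgt a0j leqNgt jn.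
Qed.

End BlockSides.

Lemma cut_apart_nonedge (E : rel nat) n u v : (u < v < n)%N -> cut_apart E n u v -> ~~ E u v.
Proof.
move=> uv [a [[_ ai _ aE] H]]; apply/negP => Euv; have a01 := ai 0 isT.
case: (aE u v uv Euv) => [[i [j [ij _ _ _]]]|[i [i0 h]]|h]; first lia.
- have Ei : i = 0%N by lia.
  by rewrite Ei in h; case: H => H; lia.
- by case: H => H; lia.
Qed.

(** * Points outside a convex drawing *)

Local Open Scope classical_set_scope.
Local Open Scope ring_scope.

Section Plane.
Variable R : realType.
Implicit Types p q x y m : R * R.

(** Twice the signed area of the triangle [p q x], positive when [x] lies to the left of the line
    from [p] to [q]. *)
Definition area p q x := (q.1 - p.1) * (x.2 - p.2) - (q.2 - p.2) * (x.1 - p.1).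

Lemma lineE p q t :
  (1 - t) *: p + t *: q = ((1 - t) * p.1 + t * q.1, (1 - t) * p.2 + t * q.2).
Proof. by case: p q => [? ?] [? ?]. Qed.

Lemma area_comb p q x y t :
  area p q ((1 - t) *: x + t *: y) = (1 - t) * area p q x + t * area p q y.
Proof. by rewrite lineE /area /=; ring. Qed.

Lemma area_cycle p q x : area q x p = area p q x.
Proof. by rewrite /area; ring. Qed.

Lemma areaC p q x : area q p x = - area p q x.
Proof. by rewrite /area; ring. Qed.

Lemma areaCr p q x : area p x q = - area p q x.
Proof. by rewrite /area; ring. Qed.

Lemma area_l p q : area p q p = 0.
Proof. by rewrite /area; ring. Qed.

Lemma area_r p q : area p q q = 0.
Proof. by rewrite /area; ring. Qed.

(** Translation by [q - p] turned clockwise through a right angle, hence to the right of the line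
    from [p] to [q]. *)
Definition push p q x := (x.1 + (q.2 - p.2), x.2 - (q.1 - p.1)).

Lemma area_push p q x : p <> q -> area p q (push p q x) < area p q x.
Proof.
move=> pq; have -> : area p q (push p q x) = area p q x -
    ((q.1 - p.1) ^+ 2 + (q.2 - p.2) ^+ 2) by rewrite /area /push /=; ring.
rewrite gtrBl lt_neqAle addr_ge0 ?sqr_ge0 // andbT eq_sym.
rewrite paddr_eq0 ?sqr_ge0 // !sqrf_eq0 !subr_eq0.
apply/negP => /andP[/eqP h1 /eqP h2]; apply: pq.
by case: p q h1 h2 {x} => [? ?] [? ?] /= -> ->.
Qed.

Lemma line_neq_l p q t : p <> q -> 0 < t -> (1 - t) *: p + t *: q <> p.
Proof.
move=> pq t0 /eqP; rewrite -subr_eq0.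
have -> : (1 - t) *: p + t *: q - p = t *: (q - p).
  by rewrite scalerBl scale1r scalerBr addrAC [p - _]addrC addrK addrC.
by rewrite scaler_eq0 gt_eqF //= subr_eq0 => /eqP/esym.
Qed.

Lemma line_neq_r p q t : p <> q -> t < 1 -> (1 - t) *: p + t *: q <> q.
Proof.
move=> pq t1; have -> : (1 - t) *: p + t *: q = (1 - (1 - t)) *: q + (1 - t) *: p.
  by rewrite subKr addrC.
by apply: line_neq_l; [move/esym|rewrite subr_gt0].
Qed.

Lemma segment_area0 p q x : segment p q x -> area p q x = 0.
Proof. by case=> t _ <-; rewrite area_comb area_l area_r; ring. Qed.

Lemma continuous_line p q : continuous (fun t : R => (1 - t) *: p + t *: q : R * R).
Proof.
move=> t; apply: (@cvgD _ (R * R)%type).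
  apply: (@cvgZr_tmp _ (R * R)%type).
  by apply: cvgB; [exact: cvg_cst|exact: cvg_id].
by apply: (@cvgZr_tmp _ (R * R)%type); exact: cvg_id.
Qed.

Lemma connected_segment p q : connected (segment p q).
Proof.
apply: connected_continuous_connected; first exact: segment_connected.
by apply: continuous_subspaceT; exact: continuous_line.
Qed.

Lemma connected_ray p q :
  connected [set (1 - t) *: p + t *: q | t in `[0, +oo[%classic].
Proof.
apply: connected_continuous_connected; first by apply/connected_intervalP; exact: interval_is_interval.
by apply: continuous_subspaceT; exact: continuous_line.
Qed.

Lemma unbounded_ray p q : p <> q ->
  ~ bounded_set [set (1 - t) *: p + t *: q | t in `[0, +oo[%classic].
Proof.
move=> pq [M0 [M0r bM]].
have nu0 : 0 < `|q - p| by rewrite normr_gt0 subr_eq0 eq_sym; apply/eqP.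
pose M := `|M0| + 1.
have M0M : M0 < M by rewrite /M (le_lt_trans (ler_norm _)) // ltrDl.
pose t := (M + `|p| + 1) / `|q - p|.
have tge : 0 <= t by rewrite divr_ge0 // /M !addr_ge0.
have := bM M M0M ((1 - t) *: p + t *: q).
apply/not_implyP; split; first by exists t => //=; rewrite in_itv /= tge.
apply/negP; rewrite -ltNge.
have -> : (1 - t) *: p + t *: q = t *: (q - p) - (- p).
  by rewrite opprK scalerBl scale1r scalerBr addrC addrA addrAC -addrA addrC -!addrA.
apply: lt_le_trans (lerB_dist _ _); rewrite normrN normrZ ger0_norm //.
by rewrite /t divfK ?gt_eqF //; lra.
Qed.

End Plane.

(** * Reaching the outer face *)

Section Outer.
Variables (R : realType) (T : finType) (e : rel T) (pos : T -> R * R).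
Implicit Types p q x y : R * R.

Lemma segmentC p q : segment p q = segment q p.
Proof.
suff H (a b : R * R) : segment a b `<=` segment b a by apply/seteqP; split; apply: H.
move=> x [t /=]; rewrite in_itv /= => /andP[t0 t1] <-; exists (1 - t).
  by rewrite /= in_itv /= subr_ge0 t1 gerBl.
by rewrite subKr addrC.
Qed.

Lemma segment_l p q : segment p q p.
Proof. by exists 0; rewrite /= ?in_itv /= ?lexx ?ler01 // subr0 scale1r scale0r addr0. Qed.

Lemma segment_r p q : segment p q q.
Proof. by rewrite segmentC; apply: segment_l. Qed.

(** The ray is connected, unbounded and disjoint from the drawing, so the component of [p] is
    unbounded. *)
Lemma outer_ray p q : p <> q ->
  (forall t, 0 <= t -> ~ drawing_set e pos ((1 - t) *: p + t *: q)) ->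
  outer_face e pos p.
Proof.
move=> pq free.
have p0 : (1 - 0) *: p + 0 *: q = p by rewrite subr0 scale1r scale0r addr0.
split; first by rewrite /setC /= -p0; apply: free.
move=> [M0 [M0r bd]]; apply: (unbounded_ray pq); exists M0; split=> // M /bd {}bd x rx.
apply: bd; move: rx; apply: connected_component_max; last exact: connected_ray.
- by exists 0; rewrite //= in_itv /= lexx.
- by move=> y [t /=]; rewrite in_itv /= andbT => t0 <-; apply: free.
Qed.

Lemma outer_segment x y : segment x y `<=` ~` drawing_set e pos ->
  outer_face e pos y -> outer_face e pos x.
Proof.
move=> free [_ ub]; split; first by apply: free; apply: segment_l.
have cxy : connected_component (~` drawing_set e pos) x y.
  exact: (connected_component_max (segment_l x y) free (@connected_segment _ x y) (segment_r x y)).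
by rewrite (same_connected_component cxy).
Qed.

Lemma closure_line x m (A : set (R * R)) :
  (forall t, 0 < t <= 1 -> A ((1 - t) *: x + t *: m)) -> closure A x.
Proof.
move=> H; have x0 : (1 - 0) *: x + 0 *: m = x by rewrite subr0 scale1r scale0r addr0.
have cv : (fun t : R => (1 - t) *: x + t *: m) t @[t --> 0^'+] --> x.
  apply: cvg_at_right_filter; rewrite -[X in _ --> X]x0; exact: continuous_line.
apply: (closed_cvg (closure A) (@closed_closure _ A) _ x cv).
near=> t; apply: subset_closure; apply: H; apply/andP; split; near: t.
- exact: nbhs_right_gt.
- exact: nbhs_right_le.
Unshelve. all: by end_near.
Qed.

(* The edges lie in a closed half plane, so a ray leaves the drawing. *)
Lemma halfplane_outer a b x : a <> b ->
  (forall v, 0 <= area a b (pos v)) -> area a b x < 0 -> outer_face e pos x.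
Proof.
move=> ab hp ax.
have dr y : drawing_set e pos y -> 0 <= area a b y.
  case=> [[v ->]//|[u [v [_ [t]]]]]; rewrite /= in_itv /= => /andP[t0 t1] <-.
  by rewrite area_comb addr_ge0 // mulr_ge0 // subr_ge0.
have nux := area_push x ab.
apply: (@outer_ray x (push a b x)) => [xnu|t t0].
  by move: nux; rewrite -xnu ltxx.
by move/dr; rewrite area_comb; nra.
Qed.

End Outer.

(** Meant for a piece of an edge with one end possibly on the line of another edge. *)
Lemma pos_comb (R : realFieldType) (s a c t : R) : 0 < t -> t < 1 -> 0 <= s * a -> 0 <= s * c ->
  0 < s * (a + c) -> 0 < s * ((1 - t) * a + t * c).
Proof.
move=> t0 t1; rewrite !mulrDr !(mulrCA s); move: (s * a) (s * c) => x y x0 y0 xy.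
by case: (ltrP 0 x) => ?; nra.
Qed.

(** * Drawings with vertices in convex position *)

Section Polygon.
Variables (R : realType) (n : nat) (P : nat -> R * R).
Hypothesis conv : forall i j l, (i < j)%N -> (j < l < n)%N -> 0 < area (P i) (P j) (P l).
Hypothesis P_inj : forall i j, (i < n)%N -> (j < n)%N -> P i = P j -> i = j.

(** In counterclockwise order, positions outside the arc from [y] to [z] lie to the left of the line
    from [P y] to [P z]; so [sg] turns the flag of [side] into the sign of [area]. *)
Definition sg b : R := if b then 1 else -1.

Lemma sgT x : sg true * x = x.
Proof. exact: mul1r. Qed.

Lemma sgF x : sg false * x = - x.
Proof. exact: mulN1r. Qed.

Lemma side_gt0 b y z l : (y < z < n)%N -> (l < n)%N -> side b y z l ->
  l <> y -> l <> z -> 0 < sg b * area (P y) (P z) (P l).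
Proof.
rewrite /side /sg => yz ln; case: b => [/orP[h|h]|h] ly lz; rewrite ?mul1r.
- by rewrite area_cycle conv //; lia.
- by rewrite conv //; lia.
- by rewrite mulN1r areaC opprK area_cycle area_cycle conv //; lia.
Qed.

Lemma side_ge0 b y z l : (y < z < n)%N -> (l < n)%N -> side b y z l ->
  0 <= sg b * area (P y) (P z) (P l).
Proof.
move=> yz ln h; have [->|/eqP ly] := eqVneq l y; first by rewrite area_l mulr0.
have [->|/eqP lz] := eqVneq l z; first by rewrite area_r mulr0.
by rewrite ltW // side_gt0.
Qed.

Definition line t i j := (1 - t) *: P i + t *: P j.

(** At most one of [P i] and [P j] lies on the line; it contributes [0], and the other one is
    strictly on the side. *)
Lemma line_side b y z i j t : (y < z < n)%N -> (i < n)%N -> (j < n)%N -> 0 < t < 1 ->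
  i <> j -> side b y z i -> side b y z j -> ~ (i = y /\ j = z) -> ~ (i = z /\ j = y) ->
  0 < sg b * area (P y) (P z) (line t i j).
Proof.
move=> yz ij jn /andP[t0 t1] nij si sj h1 h2; rewrite area_comb mulrDr !(mulrCA (sg b)).
have t1' : 0 < 1 - t by rewrite subr_gt0.
have [/orP hi|] := boolP ((i == y) || (i == z)).
  apply: ltr_wpDl; first by rewrite mulr_ge0 ?side_ge0 // ltW.
  rewrite mulr_gt0 // side_gt0 // => Ej; move: hi h1 h2 nij; rewrite Ej; clear.
    by case=> /eqP-> h1 h2 h3; [apply: h3|apply: h2].
  by case=> /eqP-> h1 h2 h3; [apply: h1|apply: h3].
rewrite negb_or => /andP[/eqP hy /eqP hz].
apply: ltr_wpDr; first by rewrite mulr_ge0 ?side_ge0 // ltW.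
by rewrite mulr_gt0 // side_gt0.
Qed.

Lemma area_hull p q l : succ_mod n p q -> (1 < n)%N -> (l < n)%N -> 0 <= area (P p) (P q) (P l).
Proof.
case=> -[E1 E2] n1 ln.
  have := @side_ge0 true p q l; rewrite /sg mul1r; apply; rewrite ?/side; lia.
rewrite areaC E2 oppr_ge0 -oppr_ge0 -mulN1r.
have := @side_ge0 false 0 p l; rewrite /sg; apply; rewrite ?/side; lia.
Qed.

Variables (T : finType) (e : rel T) (idx : T -> nat) (vt : nat -> T).
Hypothesis e_sym : symmetric e.
Hypothesis e_irr : irreflexive e.
Hypothesis idx_lt : forall v, (idx v < n)%N.
Hypothesis idxK : cancel idx vt.
Hypothesis vtK : forall i, (i < n)%N -> idx (vt i) = i.
Hypothesis deg : forall v, exists u, e v u.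
Let pos v := P (idx v).
Let E : rel nat := [rel i j | e (vt i) (vt j)].

Lemma edge_order u v : e u v -> (idx u < idx v)%N \/ (idx v < idx u)%N.
Proof.
by move=> euv; case: (ltngtP (idx u) (idx v)) => [|h|/(can_inj idxK) h]; [left|right|rewrite h e_irr in euv].
Qed.

Lemma edge_E u v : e u v -> (idx u < idx v)%N ->
  (idx u < idx v < n)%N /\ E (idx u) (idx v).
Proof. by move=> euv uv; split; [rewrite uv idx_lt|rewrite /E /= !idxK]. Qed.

Lemma edge_drawing u v x : e u v -> segment (pos u) (pos v) x ->
  exists y z, [/\ (y < z < n)%N, E y z & segment (P y) (P z) x].
Proof.
move=> euv ux; have [h|h] := edge_order euv.
  by have [? ?] := edge_E euv h; exists (idx u), (idx v).
rewrite e_sym in euv; have [? ?] := edge_E euv h.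
by exists (idx v), (idx u); split=> //; rewrite segmentC.
Qed.

(** As no vertex is isolated, the vertex points lie on edges, so a point avoiding all edges avoids
    the drawing. *)
Lemma drawing_edge x : drawing_set e pos x ->
  exists y z, [/\ (y < z < n)%N, E y z & segment (P y) (P z) x].
Proof.
case=> [[v ->]|[u [v [euv ux]]]]; last exact: edge_drawing ux.
by have [u euv] := deg v; apply: edge_drawing euv (segment_l _ _).
Qed.

Lemma free_point x : (forall y z, (y < z < n)%N -> E y z -> area (P y) (P z) x <> 0) ->
  ~ drawing_set e pos x.
Proof. by move=> H /drawing_edge[y [z [yz Eyz /segment_area0]]]; apply: H. Qed.

Definition strict x m := forall y z, (y < z < n)%N -> E y z ->
  exists b, 0 < sg b * area (P y) (P z) x /\ 0 < sg b * area (P y) (P z) m.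

(** The segment from [x] to the midpoint [m] of the polygon side meets no edge line; from [m] one
    leaves the polygon perpendicularly to that side. *)
Lemma strict_outer p q x : (1 < n)%N -> succ_mod n p q -> strict x (line 2^-1 p q) ->
  outer_face e pos x.
Proof.
set m := line _ _ _ => n1 pq xm.
have pqn : P p <> P q.
  move=> /P_inj; case: pq => -[E1 E2] H; have := H _ _; rewrite ?E1 ?E2; lia.
have hull v : 0 <= area (P p) (P q) (pos v) by apply: area_hull.
pose o := push (P p) (P q) m.
have m0 : area (P p) (P q) m = 0 by rewrite area_comb area_l area_r !mulr0 addr0.
have o0 : area (P p) (P q) o < 0 by rewrite -m0 area_push.
apply: (@outer_segment _ _ _ _ x m).
  move=> w [t /=]; rewrite in_itv /= => /andP[t0 t1] <-.
  apply: free_point => y z yz Eyz; have [b [h1 h2]] := xm y z yz Eyz.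
  move=> h; have := congr1 ( *%R (sg b)) h.
  rewrite area_comb mulr0 mulrDr !(mulrCA (sg b)).
  by move: h1 h2; set A := sg b * _; set B := sg b * _ => h1 h2; nra.
apply: (@outer_segment _ _ _ _ m o); last exact: halfplane_outer o0.
move=> w [t /=]; rewrite in_itv /= => /andP[t0 t1] <-.
have [->|tn0] := eqVneq t 0.
  rewrite subr0 scale1r scale0r addr0; apply: free_point => y z yz Eyz.
  have [b [_ h2]] := xm y z yz Eyz; move=> h.
  by move: h2; rewrite h mulr0 ltxx.
have tp : 0 < t by rewrite lt_neqAle eq_sym tn0.
have : outer_face e pos ((1 - t) *: m + t *: o); last by case.
by apply: (@halfplane_outer _ _ _ _ (P p) (P q)) => //; rewrite area_comb m0; nra.
Qed.

(** The lines of the other edges miss [x], and by convexity the edge [u v] contains no vertex but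
    its ends, which differ from [x]. *)
Lemma no_planarization u v A B x : e u v -> (idx u < idx v)%N ->
  segment (pos u) (pos v) A -> segment (pos u) (pos v) B -> A <> B ->
  open_segment A B x ->
  (forall y z, (y < z < n)%N -> E y z -> ~ (y = idx u /\ z = idx v) -> area (P y) (P z) x <> 0) ->
  ~ planarization_vertex e pos x.
Proof.
move=> euv uv [al /=]; rewrite in_itv /= => /andP[al0 al1] <- [be /=].
rewrite in_itv /= => /andP[be0 be1] <- AB [t /=]; rewrite in_itv /= => /andP[t0 t1] <- H.
have ab : al != be by apply/eqP => Eab; rewrite Eab in AB.
have [uvn Euv] := edge_E euv uv.
set x' := (X in planarization_vertex _ _ X).
(* The parameter of [x'] on the whole edge, strictly between [0] and [1] because [al] and [be]
   differ. *)
pose ga := (1 - t) * al + t * be.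
have xga : x' = (1 - ga) *: pos u + ga *: pos v.
  by rewrite /x' !lineE /ga /=; congr (_, _); ring.
have ga01 : 0 < ga < 1.
  rewrite /ga; apply/andP; split.
    case: (ltrP 0 al) => h; first by nra.
    have : 0 < be by rewrite lt_neqAle be0 andbT; apply/eqP => b0; move/eqP: ab; lra.
    by nra.
  case: (ltrP al 1) => h; first by nra.
  have : be < 1 by rewrite lt_neqAle be1 andbT; apply/eqP => b0; move/eqP: ab; lra.
  by nra.
have key a b : e a b -> segment (pos a) (pos b) x' -> [set a; b]%SET = [set u; v]%SET.
  wlog ab' : a b / (idx a < idx b)%N => [wl eab sab|eab sab].
    case: (edge_order eab) => h; first exact: wl.
    by rewrite [LHS]finset.setUC; apply: wl => //; rewrite ?(e_sym b) // segmentC.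
  have [abn Eab] := edge_E eab ab'.
  have [/andP[/eqP h1 /eqP h2]|h] := boolP ((idx a == idx u) && (idx b == idx v)).
    by rewrite (can_inj idxK h1) (can_inj idxK h2).
  case: (H _ _ abn Eab); last exact: segment_area0 sab.
  by case=> h1 h2; move: h; rewrite h1 h2 !eqxx.
case=> [[w xw]|[a [b [a' [b' [eab eab' nab sab sab']]]]]]; last first.
  by move/eqP: nab; apply; rewrite (key _ _ eab sab) (key _ _ eab' sab').
have aw : area (pos u) (pos v) (pos w) = 0.
  by rewrite -xw xga area_comb area_l area_r !mulr0 addr0.
have uvP : pos u <> pos v by move/P_inj => H'; move: uv; rewrite H' ?ltnn.
have [ga0 ga1] := andP ga01.
have [wu|wu] := eqVneq (idx w) (idx u).
  by case: (line_neq_l uvP ga0); rewrite -xga xw /pos wu.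
have [wv|wv] := eqVneq (idx w) (idx v).
  by case: (line_neq_r uvP ga1); rewrite -xga xw /pos wv.
have := side_gt0 uvn (idx_lt w) (side_total _ _ _); rewrite aw mulr0 ltxx.
by move/(_ (elimN eqP wu) (elimN eqP wv)).
Qed.

Lemma segment_sub (p q A B : R * R) : segment p q A -> segment p q B -> segment A B `<=` segment p q.
Proof.
move=> [al /=]; rewrite in_itv /= => /andP[al0 al1] <- [be /=].
rewrite in_itv /= => /andP[be0 be1] <- x [t /=]; rewrite in_itv /= => /andP[t0 t1] <-.
exists ((1 - t) * al + t * be); first by rewrite /= in_itv /=; apply/andP; split; nra.
by rewrite !lineE /=; congr (_, _); ring.
Qed.

Definition reducible_at u v := exists A B, subsegment e pos u v A B /\
  segment A B `<=` boundary (outer_face e pos).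

(** Points of the drawing are never in the outer face, so a piece in the closure of the outer face
    lies on its boundary. *)
Lemma reducible_intro u v A B : e u v -> (idx u < idx v)%N ->
  segment (pos u) (pos v) A -> segment (pos u) (pos v) B -> A <> B ->
  planarization_vertex e pos A -> planarization_vertex e pos B ->
  (forall x y z, open_segment A B x ->
    (y < z < n)%N -> E y z -> ~ (y = idx u /\ z = idx v) -> area (P y) (P z) x <> 0) ->
  (forall x, segment A B x -> closure (outer_face e pos) x) ->
  reducible_at u v.
Proof.
move=> euv uv sA sB AB pA pB H cl; exists A, B; split.
  split=> // x ox; apply: (no_planarization euv uv sA sB AB ox) => y z; exact: H.
move=> x sx; split; first exact: cl.
move=> /interior_subset[+ _]; apply; right; exists u, v; split=> //.
exact: segment_sub sx.
Qed.

(** Points of the piece are limits of points moved towards the midpoint [m] of the gap. On the line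
    [u v] itself the area is [0], so the moved point takes the sign of [m]; for the other edges the
    hypothesis applies. *)
Lemma reducible_gap u v A B p q : (1 < n)%N -> succ_mod n p q -> e u v -> (idx u < idx v)%N ->
  segment (pos u) (pos v) A -> segment (pos u) (pos v) B -> A <> B ->
  planarization_vertex e pos A -> planarization_vertex e pos B ->
  area (pos u) (pos v) (line 2^-1 p q) <> 0 ->
  (forall y z, (y < z < n)%N -> E y z -> ~ (y = idx u /\ z = idx v) ->
    exists b, [/\ 0 <= sg b * area (P y) (P z) A, 0 <= sg b * area (P y) (P z) B,
     0 < sg b * (area (P y) (P z) A + area (P y) (P z) B) &
     0 < sg b * area (P y) (P z) (line 2^-1 p q)]) ->
  reducible_at u v.
Proof.
set m := line _ _ _ => n1 pq euv uv sA sB AB pA pB m0 H.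
apply: (reducible_intro euv uv sA sB AB pA pB).
  move=> x y z [t /=]; rewrite in_itv /= => /andP[t0 t1] <- yz Eyz nyz.
  have [b [hA hB hAB _]] := H y z yz Eyz nyz.
  rewrite area_comb => /(congr1 ( *%R (sg b))); rewrite mulr0.
  apply/eqP; rewrite gt_eqF //; exact: pos_comb.
move=> x sx; apply: (@closure_line _ x m) => t /andP[t0 t1].
apply: (strict_outer n1 pq) => y z yz Eyz.
have [/andP[/eqP h1 /eqP h2]|h] := boolP ((y == idx u) && (z == idx v)).
  exists (0 < area (pos u) (pos v) m); rewrite h1 h2 (area_comb _ _ x m).
  have -> : area (P (idx u)) (P (idx v)) x = 0 by apply: segment_area0; exact: segment_sub sx.
  rewrite mulr0 add0r; suff hm : 0 < sg (0 < area (pos u) (pos v) m) * area (pos u) (pos v) m.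
    by split=> //; rewrite mulrCA mulr_gt0.
  case: (ltrP 0 (area (pos u) (pos v) m)) => h'; first by rewrite (mul1r _ : sg true * _ = _).
  by rewrite (mulN1r _ : sg false * _ = _) oppr_gt0 lt_neqAle h' andbT; apply/eqP.
have [|b [hA hB _ hm]] := H y z yz Eyz.
  by move=> [h1 h2]; move: h; rewrite h1 h2 !eqxx.
exists b; split=> //; case: sx => r /=; rewrite in_itv /= => /andP[r0 r1] <-.
rewrite (area_comb _ _ _ m) area_comb; move: hA hB hm.
set a := area _ _ A; set c := area _ _ B; set d := area _ _ m => hA hB hm.
have -> : sg b * ((1 - t) * ((1 - r) * a + r * c) + t * d) =
  (1 - t) * ((1 - r) * (sg b * a) + r * (sg b * c)) + t * (sg b * d) by ring.
apply: ltr_wpDl; last by rewrite mulr_gt0.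
by rewrite mulr_ge0 ?subr_ge0 // addr_ge0 // mulr_ge0 // subr_ge0.
Qed.

(** Here the midpoint of the gap lies on the edge itself, so the edge is approached from outside the
    polygon. *)
Lemma reducible_hull u v p q : (1 < n)%N -> succ_mod n p q -> e u v -> (idx u < idx v)%N ->
  (p = idx u /\ q = idx v) \/ (p = idx v /\ q = idx u) -> reducible_at u v.
Proof.
move=> n1 pq euv uv Epq; have [uvn Euv] := edge_E euv uv.
have uvP : pos u <> pos v by move/P_inj => H'; move: uv; rewrite H' ?ltnn.
have pqP : P p <> P q by case: Epq => -[-> ->] // /esym.
apply: (reducible_intro euv uv (segment_l _ _) (segment_r _ _) uvP).
- by left; exists u.
- by left; exists v.
- move=> x y z [t /=]; rewrite in_itv /= => /andP[t0 t1] <- yz Eyz nyz.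
  pose b := ~~ ((y <= idx u) && (idx v <= z))%N.
  have : 0 < sg b * area (P y) (P z) (line t (idx u) (idx v)).
    have uv' : idx v = (idx u).+1 \/ idx u = 0%N /\ (idx v).+1 = n.
      by case: pq Epq; lia.
    apply: line_side => //; rewrite ?t0 ?t1 ?idx_lt //; rewrite /b /side; try lia.
    + by case: ifP; lia.
    + by case: ifP; lia.
  by rewrite /line => + h; rewrite h mulr0 ltxx.
move=> x sx; have x0 : area (P p) (P q) x = 0.
  have := segment_area0 sx; case: Epq => -[-> ->] // h.
  by rewrite areaC h oppr0.
apply: (@closure_line _ x (push (P p) (P q) x)) => t /andP[t0 t1].
apply: (@halfplane_outer _ _ _ _ (P p) (P q)) => //; first by move=> w; apply: area_hull.
by rewrite area_comb x0 mulr0 add0r pmulr_rlt0 // -x0 area_push.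
Qed.

(** * Crossing points and visibility across a cut vertex *)

(** Cramer's rule: both parameters have the denominator [area B F A - area B F C], which equals
    [area A C F - area A C B]. The sign [b] covers both orientations, and [s = 1] is allowed for [C]
    on the line [B F]. *)
Lemma crossing (b : bool) (A C B F : R * R) :
  sg b * area A C B < 0 -> 0 < sg b * area A C F ->
  0 < sg b * area B F A -> sg b * area B F C <= 0 ->
  exists s t, [/\ 0 < s <= 1, sg b * area B F C < 0 -> s < 1, 0 < t < 1 &
    (1 - s) *: A + s *: C = (1 - t) *: B + t *: F].
Proof.
have Ed : area A C F - area A C B = area B F A - area B F C by rewrite /area; ring.
have line_eq : area B F A - area B F C != 0 ->
    (1 - area B F A / (area B F A - area B F C)) *: A +
      (area B F A / (area B F A - area B F C)) *: C =
    (1 - - area A C B / (area B F A - area B F C)) *: B +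
      (- area A C B / (area B F A - area B F C)) *: F.
  by rewrite !lineE /area => Dn; congr (_, _); field.
move: (area A C B) (area A C F) (area B F A) (area B F C) Ed line_eq.
move=> al be ga de Ed line_eq al0 be0 ga0 de0.
have D0 : 0 < sg b * (ga - de) by rewrite mulrBr; lra.
have Dn : ga - de != 0 by apply: contraTneq D0 => ->; rewrite mulr0 ltxx.
have sn : sg b != 0 by apply: contraTneq D0 => ->; rewrite mul0r ltxx.
have frac x : x / (ga - de) = (sg b * x) / (sg b * (ga - de)) by field; rewrite Dn sn.
have Db : sg b * (ga - de) = sg b * be - sg b * al by rewrite -Ed mulrBr.
have Dg : sg b * (ga - de) = sg b * ga - sg b * de by rewrite mulrBr.
exists (ga / (ga - de)), (- al / (ga - de)); split; last exact: line_eq.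
- by rewrite frac divr_gt0 // ler_pdivrMr // mul1r Dg; lra.
- by move=> de0'; rewrite frac ltr_pdivrMr // mul1r Dg; lra.
- rewrite frac divr_gt0 //=; last by rewrite mulrN; lra.
  by rewrite ltr_pdivrMr // mul1r mulrN Db; lra.
Qed.

Lemma polygon_crossing i j l m : (i < j < l)%N -> (l < m < n)%N ->
  exists s t, [/\ 0 < s < 1, 0 < t < 1 & line s i l = line t j m].
Proof.
move=> ijl lm.
have c1 : 0 < area (P i) (P j) (P l) by apply: conv; lia.
have c2 : 0 < area (P i) (P l) (P m) by apply: conv; lia.
have c3 : 0 < area (P i) (P j) (P m) by apply: conv; lia.
have c4 : 0 < area (P j) (P l) (P m) by apply: conv; lia.
have [] := @crossing true (P i) (P l) (P j) (P m).
- by rewrite mul1r areaCr oppr_lt0.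
- by rewrite mul1r.
- by rewrite mul1r area_cycle.
- by rewrite mul1r areaCr oppr_le0 ltW.
move=> s [t [/andP[s0 s1] s1' t01 Eq]]; exists s, t; split=> //.
by rewrite s0 s1' // mul1r areaCr oppr_lt0.
Qed.

Lemma line_segment t i j : 0 <= t <= 1 -> segment (P i) (P j) (line t i j).
Proof. by move=> t01; exists t => //=; rewrite in_itv. Qed.

(** The segment from the cut vertex to the midpoint [m] of the gap crosses [u v]. Every edge has
    [a 0] weakly and [m] strictly on the same side, so the crossing is strictly on that side too. *)
Lemma cut_apart_visible u v : (u < v < n)%N -> cut_apart E n u v ->
  exists x, segment (P u) (P v) x /\ outer_face e pos x.
Proof.
move=> uv [a [aB H]]; have gap := end_gap aB.
have [k0 ai akn _] := aB; have a01 := ai 0%N isT.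
have sides := cut_sides aB (erefl _).
have a0p : (a 0%N < (a 1%N).-1)%N by lia.
have pE : ((a 1%N).-1.+1 = a 1%N)%N by lia.
have qE : (a 1%N < n)%N /\ (if (a 1%N < n)%N then a 1%N else 0)%N = a 1%N \/
    a 1%N = n /\ (if (a 1%N < n)%N then a 1%N else 0)%N = 0%N.
  by case: (ltnP (a 1%N) n) => h; [left|right; split=> //; lia].
set p := (a 1%N).-1 in gap sides a0p pE; set q := if _ then _ else _ in gap sides qE.
clearbody p q.
have {}sides y z : (y < z < n)%N -> E y z -> exists b,
    [/\ side b y z (a 0%N), side b y z p, side b y z q,
    ~ (p = y /\ q = z) & ~ (p = z /\ q = y)].
  by move=> yz Eyz; apply: sides => //; lia.
have pn : (p < n)%N by lia.
have qn : (q < n)%N by lia.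
have pq : p <> q by case: gap; lia.
have half : 0 < (2^-1 : R) < 1 by apply/andP; split; lra.
pose m := line 2^-1 p q.
have areaM i j : area (P i) (P j) m = 2^-1 * (area (P i) (P j) (P p) + area (P i) (P j) (P q)).
  by rewrite area_comb; lra.
have an : (a 0%N < n)%N by lia.
(* [s = 1] occurs when [u] and [v] are the ends of the gap. *)
have [s [t [/andP[s0 s1] _ /andP[t0 t1] Ex]]] : exists s t,
    [/\ 0 < s <= 1, True, 0 < t < 1 & (1 - s) *: P (a 0%N) + s *: m = line t u v].
  suff [b [h1 h2 h3 h4]] : exists b, [/\ sg b * area (P (a 0%N)) m (P u) < 0,
      0 < sg b * area (P (a 0%N)) m (P v), 0 < sg b * area (P u) (P v) (P (a 0%N)) &
      sg b * area (P u) (P v) m <= 0].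
    by have [s [t [? _ ? ?]]] := crossing h1 h2 h3 h4; exists s, t.
  have [un vn] : (u < n)%N /\ (v < n)%N by split; lia.
  (* The interval contains [u] in the first case and [v] in the second, which reverses the
     orientation. *)
  rewrite ![area _ m _]area_cycle !areaM; case: H => H.
    have Eq : q = a 1%N by lia.
    have Ep : p.+1 = q by lia.
    have au : (a 0%N < u < n)%N by lia.
    have av : (a 0%N < v < n)%N by lia.
    have f1 : 0 < sg true * area (P u) (P v) (P (a 0%N)) by apply: side_gt0 => //; rewrite /side; lia.
    have f2 : 0 <= sg false * area (P u) (P v) (P p) by apply: side_ge0 => //; rewrite /side; lia.
    have f3 : 0 <= sg false * area (P u) (P v) (P q) by apply: side_ge0 => //; rewrite /side; lia.
    have f4 : 0 <= sg true * area (P (a 0%N)) (P u) (P p) by apply: side_ge0 => //; rewrite /side; lia.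
    have f5 : 0 < sg true * area (P (a 0%N)) (P u) (P q) by apply: side_gt0 => //; rewrite /side; lia.
    have f6 : 0 < sg false * area (P (a 0%N)) (P v) (P p) by apply: side_gt0 => //; rewrite /side; lia.
    have f7 : 0 <= sg false * area (P (a 0%N)) (P v) (P q) by apply: side_ge0 => //; rewrite /side; lia.
    exists true; rewrite !sgT ![area _ (P (a 0%N)) _]areaC.
    by rewrite !sgT !sgF in f1 f2 f3 f4 f5 f6 f7; split; lra.
  have ua : (u < a 0%N < n)%N by lia.
  have av : (a 0%N < v < n)%N by lia.
  have vp : (v <= p)%N by lia.
  have q0 : q = p.+1 \/ q = 0%N by case: gap; lia.
  have f1 : 0 < sg false * area (P u) (P v) (P (a 0%N)) by apply: side_gt0 => //; rewrite /side; lia.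
  have f2 : 0 <= sg true * area (P u) (P v) (P p) by apply: side_ge0 => //; rewrite /side; lia.
  have f3 : 0 <= sg true * area (P u) (P v) (P q) by apply: side_ge0 => //; rewrite /side; lia.
  have f4 : 0 < sg true * area (P u) (P (a 0%N)) (P p) by apply: side_gt0 => //; rewrite /side; lia.
  have f5 : 0 <= sg true * area (P u) (P (a 0%N)) (P q) by apply: side_ge0 => //; rewrite /side; lia.
  have f6 : 0 <= sg true * area (P (a 0%N)) (P v) (P p) by apply: side_ge0 => //; rewrite /side; lia.
  have f7 : 0 < sg true * area (P (a 0%N)) (P v) (P q) by apply: side_gt0 => //; rewrite /side; lia.
  exists false; rewrite !sgF ![area (P v) (P (a 0%N)) _]areaC.
  by rewrite !sgT !sgF in f1 f2 f3 f4 f5 f6 f7; split; lra.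
exists (line t u v); split; first by apply: line_segment; rewrite !ltW.
apply: (@strict_outer p q) => //; [lia|move=> y z yz Eyz].
have [b [b0 bp bq n1 n2]] := sides y z yz Eyz; exists b.
have hm := line_side yz pn qn half pq bp bq n1 n2.
split=> //; rewrite -Ex area_comb mulrDr !(mulrCA (sg b)).
apply: ltr_wpDl; last by rewrite mulr_gt0.
apply: mulr_ge0; first by rewrite subr_ge0.
exact: side_ge0 yz an b0.
Qed.

Lemma half01 : 0 < (2^-1 : R) < 1.
Proof. by apply/andP; split; lra. Qed.

Lemma succ_mod_lt p q : (1 < n)%N -> succ_mod n p q -> [/\ (p < n)%N, (q < n)%N & p <> q].
Proof. by move=> n1 [] [h1 h2]; split; lia. Qed.

Lemma pos_vt i : (i < n)%N -> pos (vt i) = P i.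
Proof. by move=> h; rewrite /pos vtK. Qed.

(** * Chords that no other edge separates from a gap *)

Section Chord.
Variables (u v p q : nat).
Hypothesis uv : (u < v < n)%N.
Hypothesis gap : succ_mod n p q.
Hypothesis free : forall y z, (y < z < n)%N -> E y z -> ~ (y = u /\ z = v) ->
  exists b, [/\ side b y z u, side b y z v, side b y z p, side b y z q &
    ~ (p = y /\ q = z) /\ ~ (p = z /\ q = y)].

Lemma chord_visible : ~~ E u v -> exists x, segment (P u) (P v) x /\ outer_face e pos x.
Proof.
move=> nE; have n1 : (1 < n)%N by lia.
have [pn qn pq] := succ_mod_lt n1 gap.
have [un vn uv'] : [/\ (u < n)%N, (v < n)%N & u <> v] by split; lia.
exists (line 2^-1 u v); split; first by apply: line_segment; have /andP[/ltW-> /ltW->] := half01.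
apply: (strict_outer n1 gap) => y z yz Eyz.
have nyz : ~ (y = u /\ z = v) by case=> h1 h2; rewrite -h1 -h2 Eyz in nE.
have [b [bu bv bp bq [h1 h2]]] := free yz Eyz nyz; exists b; split.
  apply: line_side => //; [exact: half01|move=> [h3 h4]; exact: nyz|lia].
by apply: line_side => //; exact: half01.
Qed.

(** The whole edge serves as the piece; the extra hypothesis keeps both ends of the gap on one side
    of it. *)
Lemma chord_reducible : E u v -> (exists b, side b u v p /\ side b u v q) ->
  reducible_at (vt u) (vt v).
Proof.
move=> Euv [b0 [b0p b0q]]; have n1 : (1 < n)%N by lia.
have [pn qn pq] := succ_mod_lt n1 gap.
have [un vn uv'] : [/\ (u < n)%N, (v < n)%N & u <> v] by split; lia.
have uv1 : (idx (vt u) < idx (vt v))%N by rewrite !vtK //; lia.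
have uvP : pos (vt u) <> pos (vt v).
  by move/P_inj => H'; move: uv1; rewrite H' ?ltnn.
have [h|h] := boolP (((p == u) && (q == v)) || ((p == v) && (q == u))).
  apply: (@reducible_hull _ _ p q) => //; rewrite !vtK //.
  by case/orP: h => /andP[/eqP-> /eqP->]; [left|right].
apply: (@reducible_gap _ _ (pos (vt u)) (pos (vt v)) p q) => //.
- exact: segment_l.
- exact: segment_r.
- by left; exists (vt u).
- by left; exists (vt v).
- rewrite !pos_vt // => m0.
  have [h1 h2] : ~ (p = u /\ q = v) /\ ~ (p = v /\ q = u).
    by split=> -[h1 h2]; rewrite h1 h2 !eqxx ?orbT in h.
  by have := line_side uv pn qn half01 pq b0p b0q h1 h2; rewrite m0 mulr0 ltxx.
- rewrite !vtK // => y z yz Eyz nyz; have [b [bu bv bp bq [h1 h2]]] := free yz Eyz nyz.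
  exists b; rewrite !pos_vt //; split.
  + exact: side_ge0.
  + exact: side_ge0.
  + have := @line_side b y z u v 2^-1 yz un vn half01 uv' bu bv.
    rewrite area_comb; move: (area _ _ (P u)) (area _ _ (P v)) => c d.
    have -> : (1 - 2^-1) * c + 2^-1 * d = 2^-1 * (c + d) by lra.
    rewrite mulrCA pmulr_rgt0 ?invr_gt0 ?ltr0n //; apply; last by lia.
    by case=> h3 h4; apply: nyz.
  + by apply: line_side => //; exact: half01.
Qed.

End Chord.

(** * The center of a zigzag *)

Section Center.
Variables (k : nat) (a : nat -> nat).
Hypothesis aB : block E n k a.

(* The crossing with a chord shifted by one position lies in the center: it avoids
   the two zigzag edges that cut off [a i] and [a j]. *)
Lemma center_crossing i j : (i.+3 <= j < k)%N -> ~ (i = 0%N /\ j.+1 = k) ->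
  exists i' j' s t, [/\ (i'.+3 <= j' < k)%N,
    forall l, (l.+1 < k)%N -> i = l \/ j = l -> i' <> l /\ j' <> l,
    0 < s < 1, 0 < t < 1 & line s (a i) (a j) = line t (a i') (a j')].
Proof.
move=> ij nij; have [_ _ akn _] := aB; have lt := block_lt aB.
have ijk : (a i < a j < a k)%N by rewrite !lt; lia.
case: i => [|i] in ij nij ijk *.
  have l1 : (a 0%N < a 1%N < a j)%N by rewrite !lt; lia.
  have l2 : (a j < a j.+1 < n)%N by apply/andP; split; [apply: lt|apply: leq_trans (lt j.+1 k _) akn]; lia.
  have [s [t [s01 t01 Est]]] := polygon_crossing l1 l2.
  by exists 1%N, j.+1, s, t; split=> //; [lia|move=> l lk; lia].
have l1 : (a i < a i.+1 < a j.-1)%N by rewrite !lt; lia.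
have l2 : (a j.-1 < a j < n)%N by apply/andP; split; [apply: lt|apply: leq_trans (lt j k _) akn]; lia.
have [s [t [s01 t01 Est]]] := polygon_crossing l1 l2.
by exists i, j.-1, t, s; split=> //; [lia|move=> l lk; lia].
Qed.

(** The witness is the crossing with the shifted chord. An edge that cuts off [a i] or [a j] leaves
    both ends of the shifted chord on the side of the gap; for any other edge [a i] and [a j] are
    there themselves. *)
Lemma center_visible i j : (i.+3 <= j < k)%N -> ~ (i = 0%N /\ j.+1 = k) ->
  ~~ E (a i) (a j) -> exists x, segment (P (a i)) (P (a j)) x /\ outer_face e pos x.
Proof.
move=> ij nij nE.
have [ik jk ij1 k1] : [/\ (i < k)%N, (j < k)%N, (i < j)%N & (1 < k)%N] by clear nij; split; lia.
have k3 : ~ (k.-1 <= 2)%N by clear nij; lia.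
have [i' [j' [s [t [ij' Q s01 t01 Est]]]]] := center_crossing ij nij.
have [ik' jk' ij1'] : [/\ (i' < k)%N, (j' < k)%N & (i' < j')%N] by clear - ij'; split; lia.
clear nij; have [_ _ akn _] := aB; have lt := block_lt aB; have inj := block_inj aB.
have aln l : (l < k)%N -> (a l < n)%N.
  by move=> lk; apply: leq_trans akn; apply: lt; rewrite lk leqnn.
have aij : (a i < a j)%N by apply: lt; rewrite ij1 ltnW.
have aij' : (a i' < a j')%N by apply: lt; rewrite ij1' ltnW.
have n1 : (1 < n)%N by apply: leq_ltn_trans (aln _ jk); apply: leq_ltn_trans aij.
have gap := end_gap aB; have [pn qn pq] := succ_mod_lt n1 gap.
exists (line s (a i) (a j)); split; first by apply: line_segment; case/andP: s01 => /ltW-> /ltW->.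
apply: (strict_outer n1 gap) => y z yz Eyz.
have [b [bp bq h S]] := end_sides aB k1 yz Eyz.
exists b; split; last first.
  have nyz : ~ (y = a 0%N /\ z = a k.-1).
    move=> [Ey Ez]; rewrite Ey Ez in Eyz; apply: k3; apply: (block_edge aB Eyz).
    by clear - k1; lia.
  by apply: line_side => //; [exact: half01|move=> H; apply: nyz; apply: h; left|
    move=> H; apply: nyz; apply: h; right].
have neq : a i <> a j by move=> E'; rewrite E' ltnn in aij.
have neq' : a i' <> a j' by move=> E'; rewrite E' ltnn in aij'.
have except l : b -> (l.+2 < k)%N -> y = a l -> z = a l.+2 -> i = l.+1 \/ j = l.+1 ->
    0 < sg b * area (P y) (P z) (line s (a i) (a j)).
  move=> bT lk2 Ey Ez El; have lk1 := ltnW lk2; have lk := ltnW lk1.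
  have [h1 h2] := Q l.+1 lk2 El.
  have out m : (m < k)%N -> m <> l.+1 -> side b y z (a m).
    move=> mk ml; case: (S m mk) => // -[_ [l' [Em lk' Ey' _]]].
    case: ml; rewrite Em; congr _.+1; apply: inj => //; last by rewrite -Ey -Ey'.
    exact: ltnW (ltnW lk').
  have {}Ey' m : (m < k)%N -> a m = y -> m = l by move=> mk E'; apply: inj; rewrite // -Ey.
  have {}Ez' m : (m < k)%N -> a m = z -> m = l.+2 by move=> mk E'; apply: inj; rewrite // -Ez.
  rewrite Est; apply: line_side => //; try exact: aln; try exact: out.
    by case=> /(Ey' _ ik') E1 /(Ez' _ jk') E2; move: ij'; rewrite E1 E2 ltnn.
  by case=> /(Ez' _ ik') E1 /(Ey' _ jk') E2; move: ij'; rewrite E1 E2; clear; lia.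
case: (S i ik) => [Si|[bT [l [Ei lk Ey Ez]]]]; last by apply: (except l) => //; left.
case: (S j jk) => [Sj|[bT [l [Ej lk Ey Ez]]]]; last by apply: (except l) => //; right.
apply: line_side => //; try exact: aln.
  by move=> [h1 h2]; rewrite h1 h2 Eyz in nE.
by case=> h1 h2; case/andP: yz; rewrite -h1 -h2 ltnNge (ltnW aij).
Qed.

Section CenterEdge.
Variable i : nat.
Hypothesis ik : (i.+2 < k)%N.
Hypothesis aE : forall l, (l.+2 < k)%N -> E (a l) (a l.+2).

Lemma crossing_planar i1 i2 j1 j2 x : (i1 < n)%N -> (i2 < n)%N -> (j1 < n)%N -> (j2 < n)%N ->
  E i1 i2 -> E j1 j2 -> i1 <> j1 -> i1 <> j2 -> segment (P i1) (P i2) x ->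
  segment (P j1) (P j2) x -> planarization_vertex e pos x.
Proof.
move=> h1 h2 h3 h4 E1 E2 n1 n2 s1 s2; right.
exists (vt i1), (vt i2), (vt j1), (vt j2); rewrite /edge_segment !pos_vt //; split=> //.
apply/eqP => /setP/(_ (vt i1)); rewrite !inE eqxx /= => /esym/orP[] /eqP/(congr1 idx);
  by rewrite !vtK.
Qed.

Let aln l : (l < k)%N -> (a l < n)%N.
Proof.
have [_ _ akn _] := aB; move=> lk; apply: leq_trans akn.
by apply: (block_lt aB); rewrite lk leqnn.
Qed.

Let alt l m : (l < m)%N -> (m < k)%N -> (a l < a m)%N.
Proof. by move=> lm mk; apply: (block_lt aB); rewrite lm ltnW. Qed.

(** The first end of the bordering piece: the crossing with the edge [a i.-1 a i.+1], or the vertex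
    [a i] if [i = 0]. The two areas concern the only edges that cut off [a i] or [a i.+2] from the
    end gap. *)
Lemma center_edge_left : exists al, [/\ 0 <= al < 1,
  planarization_vertex e pos (line al (a i) (a i.+2)),
  (0 < i)%N -> area (P (a i.-1)) (P (a i.+1)) (line al (a i) (a i.+2)) = 0 &
  (i.+3 < k)%N -> 0 < area (P (a i.+1)) (P (a i.+3)) (line al (a i) (a i.+2))].
Proof.
case: i ik => [|i'] ik'.
  exists 0; rewrite lexx ltr01 /line subr0 scale1r scale0r addr0; split=> //.
    by left; exists (vt (a 0%N)); rewrite pos_vt // aln //; clear - ik'; lia.
  move=> ik3; rewrite -[area _ _ _]sgT; apply: side_gt0.
  - by rewrite alt ?aln //; clear - ik3; lia.
  - by apply: aln; clear - ik3; lia.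
  - by rewrite /side ltnW // alt //; clear - ik3; lia.
  - by move=> E0; have := @alt 0 1 isT; rewrite -E0 ltnn; clear - ik3; lia.
  - by move=> E0; have := @alt 0 3 isT; rewrite -E0 ltnn; clear - ik3; lia.
have i3 := ik'; have i2 := ltnW i3; have i1 := ltnW i2; have i0 := ltnW i1.
have l1 : (a i' < a i'.+1 < a i'.+2)%N by rewrite !alt.
have l2 : (a i'.+2 < a i'.+3 < n)%N by rewrite alt ?aln.
have l03 : (a i' < a i'.+3)%N by apply: alt => //; clear; lia.
have [s [t [s01 t01 Est]]] := polygon_crossing l1 l2.
have [/andP[s0 s1] /andP[t0 t1]] := (s01, t01).
exists t; rewrite (ltW t0) t1 -Est; split=> //.
- apply: (@crossing_planar (a i') (a i'.+2) (a i'.+1) (a i'.+3)); rewrite ?aln ?aE //.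
  + by move=> E0; move: l1; rewrite E0 ltnn.
  + by move=> E0; move: l03; rewrite E0 ltnn.
  + by apply: line_segment; rewrite !ltW.
  + by rewrite Est; apply: line_segment; rewrite !ltW.
- by move=> _; apply: segment_area0; apply: line_segment; rewrite !ltW.
move=> i4; rewrite -[area _ _ _]sgT.
have l02 : (a i' < a i'.+2)%N by apply: alt.
have l24 : (a i'.+2 < a i'.+4)%N by apply: alt.
have l04 := ltn_trans l02 l24.
apply: line_side; rewrite ?aln ?l24 //.
- by move=> E0; rewrite E0 ltnn in l02.
- by rewrite /side ltnW.
- by rewrite /side leqnn.
- by case=> E0; rewrite E0 ltnn in l02.
- by case=> E0; rewrite E0 ltnn in l04.
Qed.

Lemma center_edge_right : exists be, [/\ 0 < be <= 1,
  planarization_vertex e pos (line be (a i) (a i.+2)),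
  (i.+3 < k)%N -> area (P (a i.+1)) (P (a i.+3)) (line be (a i) (a i.+2)) = 0 &
  (0 < i)%N -> 0 < area (P (a i.-1)) (P (a i.+1)) (line be (a i) (a i.+2))].
Proof.
have i2 := ik; have i1 := ltnW i2; have i0 := ltnW i1.
have [i3|i3] := ltnP i.+3 k; last first.
  exists 1; rewrite lexx ltr01 /line subrr scale1r scale0r add0r; split=> //.
    by left; exists (vt (a i.+2)); rewrite pos_vt // aln.
  move=> ip; have ip' : (i.-1.+1 = i)%N by clear - ip; lia.
  have l1 : (a i.-1 < a i.+1)%N by apply: alt => //; clear - ip; lia.
  have l2 : (a i.+1 < a i.+2)%N by apply: alt.
  rewrite -[area _ _ _]sgT; apply: side_gt0; rewrite ?l1 ?aln //.
  - by rewrite /side (ltnW l2) orbT.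
  - by move=> E0; move: (ltn_trans l1 l2); rewrite E0 ltnn.
  - by move=> E0; move: l2; rewrite E0 ltnn.
have l1 : (a i < a i.+1 < a i.+2)%N by rewrite !alt.
have l2 : (a i.+2 < a i.+3 < n)%N by rewrite alt ?aln.
have l13 : (a i.+1 < a i.+3)%N by apply: alt.
have l03 : (a i < a i.+3)%N by apply: alt => //; clear; lia.
have [s [t [s01 t01 Est]]] := polygon_crossing l1 l2.
have [/andP[s0 s1] /andP[t0 t1]] := (s01, t01).
exists s; rewrite s0 (ltW s1); split=> //.
- apply: (@crossing_planar (a i) (a i.+2) (a i.+1) (a i.+3)); rewrite ?aln ?aE //.
  + by move=> E0; move: l1; rewrite E0 ltnn.
  + by move=> E0; move: l03; rewrite E0 ltnn.
  + by apply: line_segment; rewrite !ltW.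
  + by rewrite Est; apply: line_segment; rewrite !ltW.
- by move=> _; rewrite Est; apply: segment_area0; apply: line_segment; rewrite !ltW.
move=> ip; have li : (a i.-1 < a i.+1)%N by apply: alt => //; clear - ip; lia.
have li3 := ltn_trans li l13.
have i_1 : (i.-1 < k)%N by clear - ip i0; lia.
rewrite -[area _ _ _]sgT Est; apply: line_side; rewrite ?aln ?li //.
- by move=> E0; rewrite E0 ltnn in l13.
- by rewrite /side leqnn orbT.
- by rewrite /side (ltnW l13) orbT.
- by case=> E0; rewrite E0 ltnn in li.
- by case=> _ E0; rewrite E0 ltnn in li3.
Qed.

(** As [3 < k], at least one of the two crossing edges exists. Such an edge has one end of the piece
    on its line and the other strictly on the side of the gap; every other edge has [a i] and
    [a i.+2] weakly on that side. *)
Lemma center_reducible : (3 < k)%N -> reducible_at (vt (a i)) (vt (a i.+2)).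
Proof.
move=> k4; have [al [al01 pA A0 A1]] := center_edge_left.
have [be [be01 pB B0 B1]] := center_edge_right.
have i2 := ik; have i1 := ltnW i2; have i0 := ltnW i1.
have k1 : (1 < k)%N by clear - k4; lia.
have uv : (a i < a i.+2)%N by apply: alt.
have [un vn] : (a i < n)%N /\ (a i.+2 < n)%N by rewrite !aln.
have uvn : (a i < a i.+2 < n)%N by rewrite uv.
have neq : a i <> a i.+2 by move=> E'; rewrite E' ltnn in uv.
have n1 : (1 < n)%N by apply: leq_ltn_trans vn; apply: leq_ltn_trans uv.
have gap := end_gap aB; have [pn qn pq] := succ_mod_lt n1 gap.
have inj := block_inj aB.
have strictM y z b : (y < z < n)%N -> E y z -> side b y z (a k).-1 ->
    side b y z (if (a k < n)%N then a k else 0%N) ->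
    ((a k).-1 = y /\ (if (a k < n)%N then a k else 0%N) = z \/
     (a k).-1 = z /\ (if (a k < n)%N then a k else 0%N) = y -> y = a 0%N /\ z = a k.-1) ->
    0 < sg b * area (P y) (P z) (line 2^-1 (a k).-1 (if (a k < n)%N then a k else 0%N)).
  move=> yz Eyz bp bq h; have nyz : ~ (y = a 0%N /\ z = a k.-1).
    move=> [Ey Ez]; rewrite Ey Ez in Eyz.
    have := block_edge aB Eyz; clear - k4; lia.
  by apply: line_side => //; [exact: half01|move=> H; apply: nyz; apply: h; left|
    move=> H; apply: nyz; apply: h; right].
have [al0 al1] := andP al01; have [be0 be1] := andP be01.
apply: (@reducible_gap _ _ (line al (a i) (a i.+2)) (line be (a i) (a i.+2)) _ _ n1 gap) => //.
- exact: aE.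
- by rewrite !vtK.
- by rewrite !pos_vt //; apply: line_segment; rewrite al0 ltW.
- by rewrite !pos_vt //; apply: line_segment; rewrite be1 ltW.
- move=> EAB; rewrite EAB in A0 A1.
  have [ip|ip] := ltnP 0 i; first by move: (B1 ip); rewrite A0 // ltxx.
  have i3 : (i.+3 < k)%N by clear - ip k4; lia.
  by move: (A1 i3); rewrite B0 // ltxx.
- rewrite !pos_vt // => m0.
  have [b [bp bq h _]] := end_sides aB k1 uvn (aE ik).
  by have := strictM _ _ _ uvn (aE ik) bp bq h; rewrite m0 mulr0 ltxx.
rewrite !vtK // => y z yz Eyz nyz.
have [b [bp bq h S]] := end_sides aB k1 yz Eyz; exists b.
have hm := strictM _ _ _ yz Eyz bp bq h.
case: (S i i0) => [Si|[bT [l [Ei lk Ey Ez]]]]; last first.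
  have ip : (0 < i)%N by rewrite Ei.
  have -> : y = a i.-1 by rewrite Ei.
  have -> : z = a i.+1 by rewrite Ei.
  rewrite bT !sgT A0 // add0r; split=> //; first by rewrite ltW // B1.
    exact: B1.
  by rewrite Ey Ez bT sgT in hm; rewrite Ei.
case: (S i.+2 i2) => [Sj|[bT [l [Ej lk Ey Ez]]]]; last first.
  have El : l = i.+1 by case: Ej.
  rewrite El in lk Ey Ez; rewrite Ey Ez bT !sgT B0 // addr0; split=> //.
  - by rewrite ltW // A1.
  - exact: A1.
  - by rewrite Ey Ez bT sgT in hm.
have sA : 0 <= sg b * area (P y) (P z) (P (a i)) by apply: side_ge0.
have sB : 0 <= sg b * area (P y) (P z) (P (a i.+2)) by apply: side_ge0.
have lineP t : 0 <= t <= 1 -> 0 <= sg b * area (P y) (P z) (line t (a i) (a i.+2)).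
  move=> /andP[t0 t1]; rewrite area_comb mulrDr !(mulrCA (sg b)).
  by apply: addr_ge0; apply: mulr_ge0; rewrite // subr_ge0.
split=> //; [by apply: lineP; rewrite al0 ltW|by apply: lineP; rewrite be1 ltW|].
(* The areas at the two ends of the piece add up to twice the area at its midpoint, an inner point
   of the edge. *)
have mid01 : 0 < (al + be) / 2 < 1 by apply/andP; split; lra.
have := line_side yz un vn mid01 neq Si Sj.
rewrite !area_comb; move: (area _ _ (P (a i))) (area _ _ (P (a i.+2))) => c d H.
have -> : sg b * ((1 - al) * c + al * d + ((1 - be) * c + be * d)) =
  2 * (sg b * ((1 - (al + be) / 2) * c + (al + be) / 2 * d)) by field.
rewrite mulr_gt0 ?ltr0n //; apply: H.
  by case=> h1 h2; apply: nyz.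
by case=> h1 h2; case/andP: yz; rewrite -h1 -h2 ltnNge (ltnW uv).
Qed.

End CenterEdge.

End Center.

Lemma coblock_spec u v : (u < v < n)%N -> coblock E n u v ->
  (~~ E u v -> exists x, segment (P u) (P v) x /\ outer_face e pos x) /\
  (E u v -> reducible_at (vt u) (vt v)).
Proof.
move=> uv [k [a [aB aE [i [j [ijk Eu Ev]]]]]].
have [ij jk] := andP ijk; have ik := ltn_trans ij jk.
have [Ej|ji1] := eqVneq j i.+1.
  rewrite Ej in jk Ev; have gap := short_gap aB jk.
  have [_ ai _ _] := aB; have lti := ai i ik.
  have free y z : (y < z < n)%N -> E y z -> ~ (y = u /\ z = v) ->
    exists b, [/\ side b y z u, side b y z v, side b y z (a i.+1).-1, side b y z (a i.+1) &
    ~ ((a i.+1).-1 = y /\ a i.+1 = z) /\ ~ ((a i.+1).-1 = z /\ a i.+1 = y)].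
    rewrite Eu Ev => yz Eyz nyz; have [b [h1 h2 h3 h4]] := short_sides aB jk yz Eyz nyz.
    exists b; split=> //; split=> //; case=> E1 E2; case/andP: yz.
    by rewrite -E1 -E2 ltnNge leq_pred.
  split; first exact: chord_visible uv gap free.
  move=> Euv; apply: (chord_reducible uv gap free Euv); exists false.
  rewrite Eu Ev /side leq_pred leqnn andbT (ltnW lti) andbT.
  by split=> //; rewrite -ltnS prednK //; apply: leq_ltn_trans lti.
have k1 : (1 < k)%N by apply: leq_ltn_trans jk; apply: leq_ltn_trans ij.
(* For [k = 3] this case contains the zigzag edge [a 0 a 2], which [center_reducible] leaves out. *)
have [/andP[/eqP i0 /eqP jk1]|ends] := boolP ((i == 0%N) && (j.+1 == k)).
  have gap := end_gap aB; have Ej : j = k.-1 by rewrite -jk1.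
  have free y z : (y < z < n)%N -> E y z -> ~ (y = u /\ z = v) ->
    exists b, [/\ side b y z u, side b y z v, side b y z (a k).-1,
      side b y z (if (a k < n)%N then a k else 0%N) &
    ~ ((a k).-1 = y /\ (if (a k < n)%N then a k else 0%N) = z) /\
    ~ ((a k).-1 = z /\ (if (a k < n)%N then a k else 0%N) = y)].
    rewrite Eu Ev i0 Ej => yz Eyz nyz; have [b [bp bq h S]] := end_sides aB k1 yz Eyz.
    exists b; split=> //.
    - by have [//|[_ [l [h1 h2 _ _]]]] := S 0%N (ltnW k1).
    - have [|//|[_ [l [h1 h2 _ _]]]] := S k.-1; first by rewrite prednK // ltnW.
      by move: h2; rewrite -h1 prednK ?ltnn // ltnW.
    - by split=> H; apply: nyz; apply: h; [left|right].
  split; first exact: chord_visible uv gap free.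
  move=> Euv; apply: (chord_reducible uv gap free Euv); exists true.
  have vk : (v < a k)%N by rewrite Ev; apply: (block_lt aB); rewrite jk leqnn.
  have vp : (v <= (a k).-1)%N by rewrite -ltnS prednK //; apply: leq_ltn_trans vk.
  by rewrite /side vp orbT; split=> //; case: ifP; rewrite ?leq0n // (ltnW vk) orbT.
have i2j : (i.+2 <= j)%N by rewrite ltn_neqAle eq_sym ji1.
have nij : ~ (i = 0%N /\ j.+1 = k) by case=> h1 h2; rewrite h1 h2 !eqxx in ends.
split=> [nE|Euv].
  rewrite Eu Ev; rewrite Eu Ev in nE; apply: (center_visible aB) => //; rewrite jk andbT ltn_neqAle i2j andbT.
  by apply: contraNneq nE => h; rewrite -h; apply: aE; rewrite h.
have Ej : j = i.+2.
  by apply/eqP; rewrite eqn_leq i2j andbT; apply: (block_edge aB) ijk; rewrite -Eu -Ev.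
rewrite Eu Ev Ej; rewrite Ej in jk; apply: (center_reducible aB jk aE).
move: nij; rewrite Ej; clear - jk; case: i jk => [|i'] jk nij; last by apply: leq_trans jk.
by rewrite ltn_neqAle jk andbT; apply/eqP => h; apply: nij.
Qed.

Hypothesis ordered : block_order E n.

Lemma visible_nonedge u v : (u < v < n)%N -> ~~ E u v ->
  exists x, segment (P u) (P v) x /\ outer_face e pos x.
Proof.
move=> uv nE; case: (ordered uv) => [/(cut_apart_visible uv)//|].
by move/(coblock_spec uv) => [/(_ nE)].
Qed.

Lemma reducible_edge u v : (u < v < n)%N -> E u v -> reducible_at (vt u) (vt v).
Proof.
move=> uv Euv; case: (ordered uv) => [/(cut_apart_nonedge uv)|]; first by rewrite Euv.
by move/(coblock_spec uv) => [_ /(_ Euv)].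
Qed.

Lemma polygon_OOR : is_OOR e pos.
Proof.
split.
- by move=> u v /P_inj /(can_inj idxK); apply.
- move=> u v w euv; rewrite /edge_segment => ws.
  wlog uv : u v euv ws / (idx u < idx v)%N => [wl|].
    case: (edge_order euv) => h; first exact: wl.
    by have [] := wl v u; rewrite 1?e_sym 1?segmentC //; [right|left].
  have [uvn _] := edge_E euv uv.
  have := segment_area0 ws => w0.
  have [wu|/eqP wu] := eqVneq (idx w) (idx u); first by left; apply: (can_inj idxK).
  have [wv|/eqP wv] := eqVneq (idx w) (idx v); first by right; apply: (can_inj idxK).
  by have := side_gt0 uvn (idx_lt w) (side_total _ _ _) wu wv; rewrite w0 mulr0 ltxx.
- move=> u v uv nuv; wlog lt : u v uv nuv / (idx u < idx v)%N => [wl|].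
    case: (ltngtP (idx u) (idx v)) => [h|h|/(can_inj idxK) h]; first exact: wl.
      by rewrite /edge_segment segmentC; apply: wl; rewrite 1?eq_sym // e_sym.
    by rewrite h eqxx in uv.
  by apply: visible_nonedge; [rewrite lt idx_lt|rewrite /E /= !idxK].
Qed.

Lemma polygon_reducible : is_reducible e pos.
Proof.
move=> u v euv; suff H a b : e a b -> (idx a < idx b)%N -> reducible_at a b.
  case: (edge_order euv) => h; first exact: H.
  have [A [B [[AB sA sB oAB] bd]]] := H v u (eq_trans (e_sym v u) euv) h.
  by exists A, B; split=> //; split; rewrite // /edge_segment segmentC.
move=> eab ab; have [abn Eab] := edge_E eab ab.
by have := reducible_edge abn Eab; rewrite !idxK.
Qed.

End Polygon.

(** * Regular polygons *)

Section Circle.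
Variable R : realType.

(** With half differences [x] and [y] of the angles, the area is the sine of [2x] plus that of [2y]
    minus that of [2x + 2y]; the product form then follows from the addition formulas and makes the
    sign visible. *)
Lemma circle_area (A B C : R) :
  area (cos A, sin A) (cos B, sin B) (cos C, sin C) =
  4 * (sin ((B - A) / 2) * sin ((C - B) / 2) * sin ((C - A) / 2)).
Proof.
have -> : area (cos A, sin A) (cos B, sin B) (cos C, sin C) =
    sin (B - A) + sin (C - B) - sin (C - A) by rewrite !sinB /area /=; ring.
set x := (B - A) / 2; set y := (C - B) / 2.
have -> : B - A = x + x by rewrite /x; field.
have -> : C - B = y + y by rewrite /y; field.
have -> : (C - A) / 2 = x + y by rewrite /x /y; field.
have -> : C - A = (x + y) + (x + y) by rewrite /x /y; field.
have cx : 1 - sin x ^+ 2 - cos x ^+ 2 = 0 by rewrite -(cos2Dsin2 x); ring.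
have cy : 1 - sin y ^+ 2 - cos y ^+ 2 = 0 by rewrite -(cos2Dsin2 y); ring.
rewrite !(sinD, cosD); move: cx cy.
move: (sin x) (cos x) (sin y) (cos y) => sx kx sy ky cx cy.
apply/eqP; rewrite -subr_eq0; apply/eqP; transitivity
  (2 * sx * kx * (1 - sy ^+ 2 - ky ^+ 2) + 2 * sy * ky * (1 - sx ^+ 2 - kx ^+ 2)).
  by ring.
by rewrite cx cy !mulr0 addr0.
Qed.

Variable n : nat.

Definition ngon (i : nat) : R * R :=
  let phi := 2 * pi * i%:R / n%:R in (cos phi, sin phi).

Lemma half_angle_sin i j : (i < j < n)%N ->
  0 < sin ((2 * pi * j%:R / n%:R - 2 * pi * i%:R / n%:R) / 2 : R).
Proof.
case/andP=> ij jn; apply: sin_gt0_pi.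
have n0 : 0 < n%:R :> R by rewrite ltr0n; apply: leq_ltn_trans jn.
have -> : (2 * pi * j%:R / n%:R - 2 * pi * i%:R / n%:R) / 2 = pi * ((j - i)%:R / n%:R) :> R.
  by rewrite natrB ?(ltnW ij) //; field; rewrite gt_eqF.
have ji : 0 < (j - i)%:R / n%:R :> R by rewrite divr_gt0 // ltr0n subn_gt0.
rewrite mulr_gt0 ?pi_gt0 //= gtr_pMr ?pi_gt0 // ltr_pdivrMr // mul1r ltr_nat.
by apply: leq_ltn_trans jn; apply: leq_subr.
Qed.

Lemma ngon_convex i j l : (i < j)%N -> (j < l < n)%N ->
  0 < area (ngon i) (ngon j) (ngon l).
Proof.
move=> ij /andP[jl ln]; rewrite circle_area !mulr_gt0 ?ltr0n // half_angle_sin //.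
- by rewrite ij (ltn_trans jl).
- by rewrite jl.
- by rewrite ln (ltn_trans ij).
Qed.

(** Equal points give [cos (B - A) = 1], while the sine of half that angle is positive. *)
Lemma ngon_inj i j : (i < n)%N -> (j < n)%N -> ngon i = ngon j -> i = j.
Proof.
wlog ij : i j / (i < j)%N => [wl|] i_n jn.
  by case: (ltngtP i j) => // h E; [apply: wl|apply/esym; apply: wl].
rewrite /ngon => -[]; set A := 2 * pi * i%:R / n%:R; set B := 2 * pi * j%:R / n%:R.
move=> Ec Es; have sx : 0 < sin ((B - A) / 2) by apply: half_angle_sin; rewrite ij.
set x := (B - A) / 2 in sx.
have : cos (x + x) = 1.
  have -> : x + x = B - A by rewrite /x; field.
  by rewrite cosB Ec Es -(cos2Dsin2 B); ring.
by rewrite cosD -(cos2Dsin2 x) => h; exfalso; nra.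
Qed.

End Circle.

Lemma regular_ngon (R : realType) (T : finType) (s : seq T) :
  uniq s -> (forall x, x \in s) -> is_regular (fun v => ngon R (size s) (index v s)).
Proof.
move=> us sT; have sE : #|T| = size s.
  by rewrite -(card_uniqP us); apply: eq_card => x; rewrite sT.
have lt v : (index v s < #|T|)%N by rewrite sE index_mem.
exists (0, 0), 1, 0, (fun v => Ordinal (lt v)); split=> //.
  apply: inj_card_bij; last by rewrite card_ord.
  by move=> u v [/(congr1 (nth u s))]; rewrite !nth_index.
by move=> v /=; rewrite !add0r !mul1r sE.
Qed.

Lemma trivial_graph_OOR (R : realType) (T : finType) (e : rel T) (pos : T -> R * R) :
  irreflexive e -> (forall u v : T, u = v) -> is_OOR e pos /\ is_reducible e pos.
Proof.
move=> e_irr one; have no u v : e u v = false by rewrite (one u v) e_irr.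
split; last by move=> u v; rewrite no.
by split=> [u v _|u v w|u v]; [exact: one|rewrite no|rewrite (one u v) eqxx].
Qed.

Theorem theorem7 (R : realType) (T : finType) (e : rel T)
    (e_sym : symmetric e) (e_irr : irreflexive e) (e_cactus : cactus e) :
  exists pos : T -> (R * R)%type,
    [/\ is_OOR e pos, is_regular pos & is_reducible e pos].
Proof.
(* The definition of a cactus admits the empty vertex set, where there is no vertex to start the
   order from. *)
case: (pickP (@predT T)) => [x0 _|noT]; last first.
  exists (fun v => ngon R (size (Nil T)) (index v [::])).
  have one (u v : T) : u = v by have := noT u.
  have [? ?] := trivial_graph_OOR (fun v => ngon R (size (Nil T)) (index v [::])) e_irr one.
  by split=> //; apply: regular_ngon => // x; have := noT x.
have [s [us sT bo]] := cactus_block_order e_sym e_irr e_cactus x0.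
exists (fun v => ngon R (size s) (index v s)).
(* A single vertex has no incident edge and is treated apart; otherwise connectedness gives every
   vertex a neighbour. *)
have [s1|s1] := leqP (size s) 1.
  have one (u v : T) : u = v.
    rewrite -(nth_index x0 (sT u)) -(nth_index x0 (sT v)); congr nth.
    have := leq_trans _ s1; move: (sT u) (sT v); rewrite -!index_mem => iu iv H.
    by have := H _ iu; have := H _ iv; rewrite !ltnS !leqn0 => /eqP-> /eqP->.
  have [? ?] := trivial_graph_OOR (fun v => ngon R (size s) (index v s)) e_irr one.
  by split=> //; apply: regular_ngon.
have deg v : exists u, e v u.
  have [u uv] : exists u, u != v.
    apply/existsP; apply: contraTT s1 => /existsPn H.
    rewrite -leqNgt -(card_uniqP us) -(card1 v); apply: subset_leq_card.
    by apply/fintype.subsetP => x _; rewrite inE; have := H x; rewrite negbK.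
  have /connectP[[|w p] /= pp Eu] := e_cactus.1 v u; first by rewrite Eu eqxx in uv.
  by exists w; case/andP: pp.
have idx_lt v : (index v s < size s)%N by rewrite index_mem.
have idxK : cancel (index^~ s) (nth x0 s) by move=> v; apply: nth_index.
have vtK i : (i < size s)%N -> index (nth x0 s i) s = i by move=> ?; apply: index_uniq.
have conv := @ngon_convex R (size s); have inj := @ngon_inj R (size s).
split; last 1 first.
- exact: (polygon_reducible conv inj e_sym e_irr idx_lt idxK vtK deg bo).
- exact: (polygon_OOR conv inj e_sym e_irr idx_lt idxK vtK deg bo).
- exact: regular_ngon.
Qed.
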